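(* Let $\mathscr{S}$ be a smooth oriented surface with unit normal $\bm{\nu}$ and curvature tensor $\nabla_{\mathrm s}\bm{\nu}=\kappa_1\bm{n}_1\otimes\bm{n}_1+\kappa_2\bm{n}_2\otimes\bm{n}_2$, hyperbolic with $\kappa_1>0>\kappa_2$, and let $\lambda>0$ and $\alpha$ be scalar fields of class $C^1$ on $\mathscr{S}$. Consider the surface tensor field $$\mathbf{F}=\mathbf{R}_{\bm{\nu}}(\alpha)\mathbf{U},\qquad \mathbf{U}=\lambda(\kappa_1\bm{n}_1\otimes\bm{n}_1-\kappa_2\bm{n}_2\otimes\bm{n}_2).$$ Then $\mathbf{F}$ satisfies the integrability condition $$\operatorname{skw}(\nabla_{\mathrm s}\mathbf{F})=\operatorname{skw}(\mathbf{F}(\nabla_{\mathrm s}\bm{\nu})\otimes\bm{\nu})$$ (so that locally $\mathbf{F}=\nabla_{\mathrm s}\bm{y}$ for a bending-neutral deformation $\bm{y}$) if and only if $\lambda$ and $\alpha$ obey the system $$\begin{cases}\nabla_{\mathrm s}(\lambda\kappa_1\cos\alpha)\cdot\bm{n}_2-\nabla_{\mathrm s}(\lambda\kappa_2\sin\alpha)\cdot\bm{n}_1=\lambda(\kappa_1+\kappa_2)(\cos\alpha\,\bm{c}\cdot\bm{n}_1+\sin\alpha\,\bm{c}\cdot\bm{n}_2),\\ \nabla_{\mathrm s}(\lambda\kappa_1\sin\alpha)\cdot\bm{n}_2+\nabla_{\mathrm s}(\lambda\kappa_2\cos\alpha)\cdot\bm{n}_1=\lambda(\kappa_1+\kappa_2)(\sin\alpha\,\bm{c}\cdot\bm{n}_1-\cos\alpha\,\bm{c}\cdot\bm{n}_2),\end{cases}$$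 where $\bm{c}:=(\nabla_{\mathrm s}\bm{n}_1)^{\mathsf T}\bm{n}_2=-(\nabla_{\mathrm s}\bm{n}_2)^{\mathsf T}\bm{n}_1$.
   Context: $\nabla_{\mathrm s}$ is the surface gradient: the gradient of any smooth extension composed on the right (last leg) with the projection $\mathbf{P}(\bm{\nu})=\mathbf{I}-\bm{\nu}\otimes\bm{\nu}$ onto the tangent plane. $\kappa_1,\kappa_2$ are the principal curvatures and $(\bm{n}_1,\bm{n}_2)$ the unit principal directions of curvature, with $(\bm{n}_1,\bm{n}_2,\bm{\nu})$ a positively oriented orthonormal frame. $\mathbf{R}_{\bm{\nu}}(\alpha)=\mathbf{I}+\sin\alpha\,\mathbf{W}(\bm{\nu})-(1-\cos\alpha)\mathbf{P}(\bm{\nu})$, with $\mathbf{W}(\bm{\nu})\bm{v}=\bm{\nu}\times\bm{v}$, is the rotation by $\alpha$ about $\bm{\nu}$. For third-rank tensors, $\operatorname{skw}$ denotes the skew-symmetric part in the last two legs. For a $C^1$ surface tensor field $\mathbf{F}$ with $\mathbf{F}\bm{\nu}=\bm{0}$, the displayed integrability condition is necessary and sufficient for the local existence of a vector field $\bm{y}$ on $\mathscr{S}$ with $\mathbf{F}=\nabla_{\mathrm s}\bm{y}$. A deformation $\bm{y}$ of $\mathscr{S}$ is bending-neutral if, in the polar decomposition $\nabla_{\mathrm s}\bm{y}=\mathbf{R}_{\bm{y}}\mathbf{U}_{\bm{y}}$ (with $\mathbf{R}_{\bm{y}}$ a field of rotations and $\mathbf{U}_{\bm{y}}$ symmetric,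 annihilating $\bm{\nu}$ and positive definite from each tangent plane to itself), $\mathbf{R}_{\bm{y}}$ is everywhere a rotation about $\bm{\nu}$. *)

(* Defs.v *)
From HB Require Import structures.
From mathcomp Require Import all_boot all_order all_algebra.
From mathcomp Require Import all_classical all_reals all_analysis.

Set Implicit Arguments.
Unset Strict Implicit.
Unset Printing Implicit Defensive.

Import Order.TTheory GRing.Theory Num.Theory.
Import numFieldNormedType.Exports.

Local Open Scope classical_set_scope.
Local Open Scope ring_scope.

Section VectorsAndTensors.
Variable R : realType.
Implicit Types (u v w nu : 'cV[R]_3) (A : 'M[R]_3).

Definition dot u v : R := \sum_(i < 3) u i 0 * v i 0.

(* Indices live in 'I_3 = Z/3, so i + 1 and i + 2 are taken cyclically. *)
Definition cross u v : 'cV[R]_3 :=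
  \col_i (u (i + 1) 0 * v (i + 2%:R) 0 - u (i + 2%:R) 0 * v (i + 1) 0).

Definition outer u v : 'M[R]_3 := u *m v^T.

Definition tproj nu : 'M[R]_3 := 1%:M - outer nu nu.

(* The matrix of v |-> nu x v: its j-th column is nu x e_j. *)
Definition crossmx nu : 'M[R]_3 :=
  \matrix_(i, j) cross nu (delta_mx j 0) i 0.

Definition rotmx nu (a : R) : 'M[R]_3 :=
  1%:M + sin a *: crossmx nu - (1 - cos a) *: tproj nu.

Definition is_rotation A : Prop := A^T *m A = 1%:M /\ \det A = 1.

(* (u, v, w) is a positively oriented orthonormal frame iff the matrix with
   columns u, v, w is a rotation. *)
Definition pos_frame u v w : Prop :=
  is_rotation (\matrix_(i, j) [:: u; v; w]`_j i 0).

Definition tensor3 := 'I_3 -> 'I_3 -> 'I_3 -> R.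

(* A (x) v *)
Definition outer21 A v : tensor3 := fun i j k => A i j * v k 0.

Definition skw (T : tensor3) : tensor3 :=
  fun i j k => 2^-1 * (T i j k - T i k j).

End VectorsAndTensors.

Section Regularity.
Variable R : realType.

(* Class C^k on the open set D. *)
Fixpoint Ck (E V : normedModType R) (k : nat) (D : set E) (f : E -> V) : Prop :=
  match k with
  | 0 => forall x, D x -> {for x, continuous f}
  | k'.+1 => (forall x, D x -> differentiable f x) /\
             (forall v : E, Ck k' D (fun x => 'D_v f x))
  end.

Definition smooth (E V : normedModType R) (D : set E) (f : E -> V) : Prop :=
  forall k, Ck k D f.

End Regularity.

Section Surfaces.
Variable R : realType.
Local Notation E := 'cV[R]_3.
Implicit Types (S : set E) (nu : E -> E) (p : E).

(* Embedded smooth surface, by adapted charts: near each of its points, S is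
   carried by a smooth diffeomorphism Phi : D -> Phi(D) between open sets of
   R^3, with inverse Psi, onto the part of Phi(D) in the plane x_3 = 0. *)
Definition smooth_surface S : Prop :=
  forall p, S p -> exists D : set E, exists Phi Psi : E -> E,
    [/\ [/\ open D, D p & open (Phi @` D)],
        smooth D Phi, smooth (Phi @` D) Psi,
        forall x, D x -> Psi (Phi x) = x
      & forall x, D x -> (S x <-> Phi x ord_max 0 = 0)].

(* v is the velocity at p of a curve lying on S. *)
Definition tangent S p (v : E) : Prop :=
  exists gamma : R -> E,
    [/\ gamma 0 = p, \forall t \near (0 : R), S (gamma t)
      & is_derive (0 : R) (1 : R) gamma v].

(* Fields on S are functions on R^3 of which only the values on S matter;
   they are of class C^k when they locally extend to C^k functions. *)
Definition Ck_field (V : normedModType R) (k : nat) S (f : E -> V) : Prop :=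
  forall p, S p -> exists D : set E, exists g : E -> V,
    [/\ open D, D p, Ck k D g & forall x, D x -> S x -> g x = f x].

Definition smooth_field (V : normedModType R) S (f : E -> V) : Prop :=
  forall p, S p -> exists D : set E, exists g : E -> V,
    [/\ open D, D p, smooth D g & forall x, D x -> S x -> g x = f x].

Definition unit_normal S nu : Prop :=
  smooth_field S nu /\
  forall p, S p -> dot (nu p) (nu p) = 1 /\
                   forall v, tangent S p v -> dot (nu p) v = 0.

Definition is_extension (V : normedModType R) S (f : E -> V) p (g : E -> V) :=
  differentiable g p /\ \forall x \near p, S x -> g x = f x.

(* Some extension of f off S near p; it is unspecified when there is none. *)
Definition extension (V : normedModType R) S (f : E -> V) p : E -> V :=
  get (is_extension S f p).

(* The surface gradient at p as the linear map v |-> Dg(p)(P(nu) v), where g is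
   an extension of f. It does not depend on g when nu is a unit normal of S. *)
Definition sder (V : normedModType R) S nu (f : E -> V) p (v : E) : V :=
  'd (extension S f p) p (tproj (nu p) *m v).

(* Components of the surface gradient of a scalar, vector and tensor field; the
   differentiation index comes last. *)
Definition sgrad0 S nu (f : E -> R) p : E :=
  \col_k sder (V := R^o) S nu f p (delta_mx k 0).

Definition sgrad1 S nu (f : E -> E) p : 'M[R]_3 :=
  \matrix_(i, k) sder S nu f p (delta_mx k 0) i 0.

Definition sgrad2 S nu (f : E -> 'M[R]_3) p : tensor3 R :=
  fun i j k => sder S nu f p (delta_mx k 0) i j.

(* A = Q *m U with Q a rotation and U symmetric, annihilating n and positive
   definite on the plane orthogonal to n (which U then maps to itself). *)
Definition polar_decomposition (n : E) (A Q U : 'M[R]_3) : Prop :=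
  [/\ A = Q *m U, is_rotation Q, U^T = U, U *m n = 0
    & forall v : E, v != 0 -> dot n v = 0 -> 0 < dot v (U *m v)].

Definition bending_neutral S nu (y : E -> E) : Prop :=
  Ck_field 1 S y /\
  exists Ry Uy : E -> 'M[R]_3, forall p, S p ->
    polar_decomposition (nu p) (sgrad1 S nu y p) (Ry p) (Uy p) /\
    exists a : R, Ry p = rotmx (nu p) a.

End Surfaces.

(* Main.v *)
Require Import Defs.
From HB Require Import structures.
From mathcomp Require Import all_boot all_order all_algebra.
From mathcomp Require Import all_classical all_reals all_analysis.
From mathcomp Require Import ring lra.

Set Implicit Arguments.
Unset Strict Implicit.
Unset Printing Implicit Defensive.

Import Order.TTheory GRing.Theory Num.Theory.
Import numFieldNormedType.Exports.

Local Open Scope classical_set_scope.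
Local Open Scope ring_scope.

(** Write F = a (x) n1 + b (x) n2 with a = F n1 and b = F n2: since the rotation
is about nu, a = lambda k1 (cos alpha n1 + sin alpha n2) and
b = lambda k2 (sin alpha n1 - cos alpha n2). The integrability condition is an
identity between alternating bilinear maps, so it is enough to test it on the
pairs of the frame (n1, n2, nu). As nu . d n_i = - n_i . d nu, the pairs
(n1, nu) and (n2, nu) give k1 a = k1 a and k2 b = k2 b, and the identity always
holds on them. The pair (n1, n2) gives the vector equation
  d_2 a - d_1 b = c1 a + c2 b,   c1 = c . n1,  c2 = c . n2.
Its component along nu reads k1 b1 = k2 a2, with a2 = a . n2 and b1 = b . n1,
which holds for these a and b: this is where the special stretching tensor is
needed. Its components along n1 and n2 are the two equations of the system
([frame_curl], [ext_integrable_pde]).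

For the deformation, let Phi be an adapted chart near p, Psi its inverse, and
flatten the target of Phi by dropping the third coordinate. The condition,
restricted to tangent vectors, says that DF(u) v is symmetric in u and v;
together with the symmetry of the second derivatives of Psi ([derive_sym]) it
makes the rows of F d(Psi o flat) closed 1-forms on a ball of R^3
([chart_coef_closed]). The Poincare lemma ([poincare]) gives primitives Y_i on
that ball, and y = Y o Phi has surface gradient F ([local_primitive]). The
Poincare primitive is the integral along segments from the centre; the
derivative under the integral sign is turned by closedness into
d/dt (t omega(w0 + t u) v), whose integral is known.

All derivatives along the surface are directional derivatives of arbitrary
differentiable extensions: two extensions have the same derivative along every
velocity of a curve on S, and these velocities are the vectors orthogonal to nu
([orth_tangent], [sderE]). *)

(** * Differentiation of matrix-valued fields *)

Section MatrixFields.
Variables (R : realType) (E : normedModType R) (m n : nat).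
Implicit Types (M : E -> 'M[R]_(m, n)) (x v : E).

Lemma differentiable_mxP M x :
  differentiable M x <-> forall i j, differentiable (fun y => M y i j) x.
Proof.
split=> [dM i j|dM].
  exact: (@differentiable_comp _ _ _ _ M (fun N : 'M[R]_(m, n) => N i j) x
    dM (differentiable_coord _ _ _)).
have -> : M = \sum_i \sum_j (fun y => M y i j *: delta_mx i j).
  apply/funext => y; rewrite fct_sumE [LHS]matrix_sum_delta.
  by apply: eq_bigr => i _; rewrite fct_sumE.
apply: differentiable_sum => i; apply: differentiable_sum => j.
exact: differentiableZl.
Qed.

Lemma derive_mxE M x v i j : differentiable M x ->
  ('D_v M x) i j = 'D_v (fun y => M y i j) x.
Proof.
by move=> dM; rewrite derive_mx ?mxE//; exact: diff_derivable.
Qed.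

Lemma continuous_mxP M x :
  {for x, continuous M} <-> forall i j, {for x, continuous (fun y => M y i j)}.
Proof.
split=> [cM i j|cM].
  exact: (@continuous_comp _ _ _ M (fun N : 'M[R]_(m, n) => N i j) x cM
    (@coord_continuous _ _ _ i j _)).
apply/cvgrPdist_lt => e e0; near=> y.
rewrite [ltLHS]/Num.Def.normr/= mx_normrE.
apply/bigmax_ltP; split=> // -[i j] _; rewrite !mxE/=.
move: (i) (j); near: y.
suff : \forall y \near x, forall ij : 'I_m * 'I_n,
    `|M x ij.1 ij.2 - M y ij.1 ij.2| < e.
  by apply: filterS => y H i j; exact: (H (i, j)).
apply: filter_forall => -[i j] /=.
by have /cvgrPdist_lt/(_ _ e0) := cM i j.
Unshelve. all: by end_near. Qed.

End MatrixFields.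

Lemma derive_comp (R : realType) (E F G : normedModType R) (g : F -> G)
    (f : E -> F) x v :
  differentiable f x -> differentiable g (f x) ->
  'D_v (g \o f) x = 'D_('D_v f x) g (f x).
Proof.
move=> df dg; rewrite deriveE; last exact: differentiable_comp.
by rewrite diff_comp//= -!deriveE.
Qed.

Lemma derive_coord (R : realType) n (G : normedModType R) (f : 'cV[R]_n -> G) x v :
  differentiable f x -> 'D_v f x = \sum_i v i 0 *: 'D_(delta_mx i 0) f x.
Proof.
move=> df; rewrite deriveE// [in LHS](matrix_sum_delta v) linear_sum.
by apply: eq_bigr => i _; rewrite big_ord1 linearZ deriveE.
Qed.

(** The differential of f at x is defined by choice, so differentiability is
deduced from an explicit linear approximation through the uniqueness of the
latter. *)
Lemma differentiable_approx (R : realType) (V W : normedModType R) (f : V -> W)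
    (L : {linear V -> W}) x : continuous L ->
  (forall e : R, 0 < e ->
     \forall h \near 0, `|f (h + x) - (f x + L h)| <= e * `|h|) ->
  differentiable f x.
Proof.
move=> cL fL; suff fE : f \o shift x = cst (f x) + L +o_ 0 id.
  by apply/diff_locallyP; rewrite (diff_unique cL fE).
by apply/eqaddoP => e e0; exact: fL.
Qed.

Lemma near_eq_differentiable (R : realType) (V W : normedModType R) (f g : V -> W) x :
  (\forall y \near x, f y = g y) -> differentiable f x -> differentiable g x.
Proof.
move=> fg df; apply: (@differentiable_approx R V W g ('d f x) x).
  exact: diff_continuous.
have /eqaddoP fo := diff_locally df.
move=> e e0; have fe := fo e e0.
have fg0 : \forall h \near 0, f (h + x) = g (h + x).
  have /nbhs_ballP[d /= d0 dfg] := fg; apply/nbhs_ballP; exists d => // h.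
  rewrite -ball_normE/= sub0r normrN => hd; apply: dfg; rewrite -ball_normE/=.
  by rewrite opprD addrCA subrr addr0 normrN.
apply: filterS2 fg0 fe => h fgh; rewrite -fgh -(nbhs_singleton fg).
by [].
Qed.

Lemma near_eq_continuous (E T : topologicalType) (f g : E -> T) x :
  (\forall y \near x, f y = g y) -> {for x, continuous f} -> {for x, continuous g}.
Proof.
move=> fg cf; rewrite /prop_for /continuous_at -(nbhs_singleton fg).
by apply: cvg_trans cf; exact: near_eq_cvg.
Qed.

(** * Calculus of C^1 functions *)

Section C1.
Variables (R : realType) (E : normedModType R).
Implicit Types (D : set E) (f g : E -> R) (x v : E).

Lemma Ck_sub (V : normedModType R) k D D' (f : E -> V) :
  D' `<=` D -> Ck k D f -> Ck k D' f.
Proof.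
move=> DD; elim: k f => [|k IH] f /=; first by move=> h x /DD /h.
by move=> [d1 d2]; split=> [x /DD /d1 //|v]; exact: IH.
Qed.

(** A formula for the derivatives on D only gives their continuity because D is
open: the formula then holds near each point. *)
Lemma C1_intro (V : normedModType R) D (f : E -> V) (df : E -> E -> V) :
  open D -> (forall x, D x -> differentiable f x) ->
  (forall v x, D x -> 'D_v f x = df v x) ->
  (forall v x, D x -> {for x, continuous (df v)}) -> Ck 1 D f.
Proof.
move=> oD d dE dc; split=> // v x Dx.
apply: near_eq_continuous (dc v x Dx).
by apply: filterS (open_nbhs_nbhs (conj oD Dx)) => y Dy; rewrite dE.
Qed.

Lemma C1_continuous (V : normedModType R) D (f : E -> V) x :
  Ck 1 D f -> D x -> {for x, continuous f}.
Proof. by move=> [df _] Dx; exact/differentiable_continuous/df. Qed.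

Lemma C1_mxP m n D (M : E -> 'M[R]_(m, n)) : open D ->
  Ck 1 D M <-> forall i j, Ck 1 D (fun y => M y i j).
Proof.
move=> oD; split=> [[dM cM] i j|CM].
  apply: (C1_intro (df := fun v x => ('D_v M x) i j)) => // [x Dx|v x Dx|v x Dx].
  - exact: (differentiable_mxP M x).1 (dM x Dx) i j.
  - by rewrite derive_mxE//; exact: dM.
  - exact: (continuous_mxP ('D_v M) x).1 (cM v x Dx) i j.
have dM x : D x -> differentiable M x.
  by move=> Dx; apply/differentiable_mxP => i j; exact: (CM i j).1.
split=> // v x Dx; apply: (near_eq_continuous
    (f := fun x => \matrix_(i, j) 'D_v (fun y => M y i j) x)).
  apply: filterS (open_nbhs_nbhs (conj oD Dx)) => y Dy.
  by rewrite derive_mx//; apply: diff_derivable; exact: dM.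
apply/continuous_mxP => i j.
by apply: near_eq_continuous ((CM i j).2 v x Dx); apply: nearW => y; rewrite mxE.
Qed.

Lemma C1_cst D (a : R) : Ck 1 D (fun=> a : R).
Proof.
split=> [x _|v x _]; first exact: differentiable_cst.
rewrite (_ : 'D_v _ = cst 0); first exact: cst_continuous.
by apply/funext => y; rewrite derive_cst.
Qed.

Lemma C1D D f g : open D -> Ck 1 D f -> Ck 1 D g -> Ck 1 D (fun x => f x + g x).
Proof.
move=> oD [df cf] [dg cg].
apply: (C1_intro (df := fun v x => 'D_v f x + 'D_v g x)) => // [x Dx|v x Dx|v x Dx].
- by apply: differentiableD; [exact: df|exact: dg].
- by rewrite deriveD//; apply: diff_derivable; [exact: df|exact: dg].
- by apply: cvgD; [exact: cf|exact: cg].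
Qed.

Lemma C1M D f g : open D -> Ck 1 D f -> Ck 1 D g -> Ck 1 D (fun x => f x * g x).
Proof.
move=> oD Cf Cg; have [[df cf] [dg cg]] := (Cf, Cg).
apply: (C1_intro (df := fun v x => f x * 'D_v g x + g x * 'D_v f x)) => // [x Dx|v x Dx|v x Dx].
- by apply: differentiableM; [exact: df|exact: dg].
- by rewrite deriveM//; apply: diff_derivable; [exact: df|exact: dg].
- have cf' := C1_continuous Cf Dx; have cg' := C1_continuous Cg Dx.
  by apply: cvgD; apply: cvgM => //; [exact: cg|exact: cf].
Qed.

Lemma C1N D f : open D -> Ck 1 D f -> Ck 1 D (fun x => - f x).
Proof.
move=> oD Cf; rewrite (_ : (fun _ => _) = fun x => -1 * f x).
  exact (C1M oD (@C1_cst D (-1)) Cf).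
by apply/funext => x; rewrite mulN1r.
Qed.

Lemma C1_sum (I : Type) (r : seq I) D (f : I -> E -> R) : open D ->
  (forall i, Ck 1 D (f i)) -> Ck 1 D (fun x => \sum_(i <- r) f i x).
Proof.
move=> oD Cf; elim: r => [|i r IH].
  rewrite (_ : (fun _ => _) = fun=> 0); first exact: C1_cst.
  by apply/funext => x; rewrite big_nil.
rewrite (_ : (fun _ => _) = fun x => f i x + \sum_(i <- r) f i x).
  exact (@C1D D (f i) (fun x => \sum_(i <- r) f i x) oD (Cf i) IH).
by apply/funext => x; rewrite big_cons.
Qed.

Lemma C1_comp1 D f (phi dphi : R -> R) : open D ->
  (forall t : R, is_derive t 1 phi (dphi t)) -> continuous dphi ->
  Ck 1 D f -> Ck 1 D (phi \o f).
Proof.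
move=> oD dphiP cphi Cf; have [df cf] := Cf.
have dphi' t : differentiable phi t by apply/derivable1_diffP.
apply: (C1_intro (df := fun v x => 'D_v f x * dphi (f x))) => // [x Dx|v x Dx|v x Dx].
- by apply: differentiable_comp => //; exact: df.
- rewrite deriveE; last by apply: differentiable_comp => //; exact: df.
  rewrite diff_comp//; last exact: df.
  rewrite [LHS]/= -(deriveE v (df x Dx)).
  by rewrite diff1E// derive1E derive_val.
- apply: cvgM; first exact: cf.
  by apply: continuous_comp (cphi _); exact: C1_continuous Cf Dx.
Qed.

Lemma C1_sin D f : open D -> Ck 1 D f -> Ck 1 D (fun x => sin (f x)).
Proof. by move=> oD; apply: (C1_comp1 (phi := @sin R) oD) => //; exact: continuous_cos. Qed.

Lemma C1_cos D f : open D -> Ck 1 D f -> Ck 1 D (fun x => cos (f x)).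
Proof.
move=> oD; apply: (C1_comp1 (phi := @cos R) oD) => //.
by move=> t; apply: cvgN; exact: continuous_sin.
Qed.

End C1.

Lemma C1_eq (R : realType) (V W : normedModType R) (D : set V) (f g : V -> W) : open D ->
  (forall x, D x -> f x = g x) -> Ck 1 D f -> Ck 1 D g.
Proof.
move=> oD fg [df cf].
have nfg x : D x -> \forall y \near x, f y = g y.
  by move=> Dx; apply: filterS (open_nbhs_nbhs (conj oD Dx)) => y; exact: fg.
apply: (C1_intro (df := fun v => 'D_v f) oD) => //.
- by move=> x Dx; apply: near_eq_differentiable (nfg x Dx) (df x Dx).
- by move=> v x Dx; apply/esym/near_eq_derive/nfg.
Qed.

Lemma C1_comp (R : realType) (E : normedModType R) n (D : set E) (D' : set 'cV[R]_n)
    (f : 'cV[R]_n -> R) (X : E -> 'cV[R]_n) : open D ->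
  (forall x, D x -> D' (X x)) -> Ck 1 D X -> Ck 1 D' f -> Ck 1 D (f \o X).
Proof.
move=> oD DD' CX Cf; have [[dX cX] [df cf]] := (CX, Cf).
have dfX x : D x -> differentiable f (X x) by move=> /DD'; exact: df.
apply: (C1_intro (V := R) (df := fun v x =>
    \sum_k ('D_v X x) k 0 * 'D_(delta_mx k 0) f (X x)) oD).
- by move=> x Dx; apply: differentiable_comp; [exact: dX|exact: dfX].
- move=> v x Dx; rewrite (derive_comp v (dX x Dx) (dfX x Dx)).
  by rewrite (derive_coord _ (dfX x Dx)).
- move=> v x Dx.
  apply: (@cvg_big _ _ _ _ _ _ _ _ _ _ (fun k => ('D_v X x) k 0 * 'D_(delta_mx k 0) f (X x))).
    exact: add_continuous.
  move=> k _; apply: cvgM.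
    exact: ((continuous_mxP ('D_v X) x).1 (cX v x Dx) k 0).
  apply: (@continuous_comp _ _ _ X ('D_(delta_mx k 0) f) x (C1_continuous CX Dx)).
  by apply: cf; exact: DD'.
Qed.

(** * Symmetry of second derivatives *)

Section Lines.
Variables (R : realType) (E : normedModType R).
Implicit Types (f : E -> R) (x u v : E) (s t h : R).

Lemma is_derive_line f x v s : derivable f (x + s *: v) v ->
  is_derive s (1 : R) (fun t => f (x + t *: v)) ('D_v f (x + s *: v)).
Proof.
move=> df.
have eq_quot : (fun h => h^-1 *: (((fun t => f (x + t *: v)) \o shift s) (h *: 1)
      - f (x + s *: v))) =
    (fun h => h^-1 *: ((f \o shift (x + s *: v)) (h *: v) - f (x + s *: v))).
  apply/funext => h /=; congr (_ *: (f _ - _)).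
  by rewrite scalerDl [h *: 1]mulr1 addrCA.
by split; [rewrite /derivable eq_quot|rewrite /derive eq_quot].
Qed.

Lemma MVT_line f x v h : 0 < h ->
  (forall s, 0 <= s <= h -> derivable f (x + s *: v) v) ->
  exists2 s : R, 0 <= s <= h & f (x + h *: v) - f x = h * 'D_v f (x + s *: v).
Proof.
move=> h0 df.
have [||s] := @MVT R (fun t => f (x + t *: v)) (fun s => 'D_v f (x + s *: v)) 0 h h0.
- move=> s /itvP sh; apply: is_derive_line; apply: df.
  by rewrite !sh.
- apply: derivable_within_continuous => s; rewrite in_itv/= => sh.
  by have [] := is_derive_line (df s sh).
move=> /itvP sh; rewrite scale0r addr0 subr0 mulrC => ->; exists s => //.
by rewrite !sh.
Qed.

Lemma near_plane (x u v : E) (N : set E) : nbhs x N ->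
  exists2 h : R, 0 < h & forall s t : R, 0 <= s <= h -> 0 <= t <= h -> N (x + s *: u + t *: v).
Proof.
move=> /nbhs_ballP[r /= r0 rN]; pose d := `|u| + `|v| + 1.
have d0 : 0 < d by rewrite ltr_wpDl// addr_ge0.
exists (r / d); first by rewrite divr_gt0.
move=> s t /andP[s0 sh] /andP[t0 th]; apply: rN; rewrite -ball_normE/=.
rewrite -addrA opprD addNKr normrN (le_lt_trans (ler_normD _ _))//.
rewrite !normrZ !ger0_norm//.
apply: (@le_lt_trans _ _ (r / d * (`|u| + `|v|))).
  by rewrite mulrDr lerD// ler_wpM2r.
by rewrite mulrAC ltr_pdivrMr// ltr_pM2l// ltrDl.
Qed.

(** The mean value theorem, applied in the direction u to y |-> f (y + h v) - f
y and then in the direction v to the derivative of f along u. *)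
Lemma second_difference f x u v h : 0 < h ->
  (forall s t, 0 <= s <= h -> 0 <= t <= h ->
     derivable f (x + s *: u + t *: v) u /\
     derivable ('D_u f) (x + s *: u + t *: v) v) ->
  exists s t a : R, [/\ 0 <= s <= h, 0 <= t <= h,
    a = 'D_v ('D_u f) (x + s *: u + t *: v) &
    f (x + h *: u + h *: v) - f (x + h *: u) - (f (x + h *: v) - f x) =
    h * (h * a)].
Proof.
move=> h0 df.
have hh : 0 <= h <= h by rewrite (ltW h0)/=.
have h00 : 0 <= (0 : R) <= h by rewrite lexx (ltW h0).
pose g y := f (y + h *: v) - f y.
have gE s : 0 <= s <= h -> is_derive (x + s *: u) u g
    ('D_u f (x + s *: u + h *: v) - 'D_u f (x + s *: u)).
  move=> sh; have [d1 _] := df s h sh hh; have [d2 _] := df s 0 sh h00.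
  rewrite scale0r addr0 in d2.
  apply: is_deriveB; last exact: derivableP.
  have eq_quot : (fun k => k^-1 *: (((fun y => f (y + h *: v)) \o shift (x + s *: u)) (k *: u)
      - f (x + s *: u + h *: v))) =
    (fun k => k^-1 *: ((f \o shift (x + s *: u + h *: v)) (k *: u) - f (x + s *: u + h *: v))).
    by apply/funext => k /=; rewrite -!addrA.
  by split; [rewrite /derivable eq_quot|rewrite /derive eq_quot].
have [|s sh Eg] := @MVT_line g x u h h0; first by move=> s /gE[].
have [|t th Ef] := @MVT_line ('D_u f) (x + s *: u) v h h0.
  by move=> t th; have [] := df s t sh th.
exists s, t, ('D_v ('D_u f) (x + s *: u + t *: v)); split=> //; rewrite -Ef.
have [_ <-] := gE s sh; rewrite -Eg /g.
by rewrite addrAC.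
Qed.

(** The second difference of f is symmetric in u and v, so both mixed
derivatives take, at points arbitrarily close to x, one and the same value;
their continuity at x makes them equal there. *)
Lemma derive_sym (D : set E) f x u v : open D -> D x ->
  (forall y, D y -> differentiable f y) ->
  Ck 1 D ('D_u f) -> Ck 1 D ('D_v f) ->
  'D_v ('D_u f) x = 'D_u ('D_v f) x.
Proof.
move=> oD Dx df [duf cuf] [dvf cvf]; apply/eqP/negPn/negP => neq.
pose A : R := 'D_v ('D_u f) x; pose B : R := 'D_u ('D_v f) x.
have {}neq : A != B by [].
have e0 : 0 < `|A - B| / 2 by rewrite divr_gt0// normr_gt0 subr_eq0.
have /cvgrPdist_lt/(_ _ e0) nA := cuf v x Dx.
have /cvgrPdist_lt/(_ _ e0) nB := cvf u x Dx.
have nD := open_nbhs_nbhs (conj oD Dx).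
have [h h0 H] := near_plane u v (filterI nD (filterI nA nB)).
have [|s [t [a [sh th aE E1]]]] := @second_difference f x u v h h0.
  move=> s t sh th; have [Dst _] := H s t sh th.
  by split; apply: diff_derivable; [exact: df|exact: duf].
have [|t' [s' [b [th' sh' bE E2]]]] := @second_difference f x v u h h0.
  move=> t' s' th' sh'; have [] := H s' t' sh' th'; rewrite (addrAC x) => Dst _.
  by split; apply: diff_derivable; [exact: df|exact: dvf].
have [_ [/= HA _]] := H s t sh th.
have [_ [_ /= HB]] := H s' t' sh' th'.
rewrite (addrAC x (s' *: u)) in HB.
rewrite -aE in HA; rewrite -bE in HB.
suff ab : a = b.
  rewrite ab in HA; have := ltrD HA HB.
  rewrite -splitr => /(le_lt_trans (ler_normB _ _)).
  by rewrite opprB addrA subrK ltxx.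
have hn : h != 0 by rewrite gt_eqF.
apply: (mulfI hn); apply: (mulfI hn).
rewrite -E1 -E2 (addrAC x (h *: v)) !opprB.
by rewrite addrACA [RHS]addrACA [- _ - _]addrC.
Qed.

End Lines.

(** * The Poincare lemma on a ball *)

Section Leibniz.
Variable R : realType.
Local Notation mu := (@lebesgue_measure R).

(** Leibniz rule. The derivative g of the integrand is continuous on the compact
rectangle [-e, e] x [0, 1], hence bounded there, which gives the domination that
differentiation under the integral sign requires. *)
Lemma derive_Rintegral (f g : R -> R -> R) (e : R) : 0 < e ->
  (forall h t : R, - e <= h <= e -> 0 <= t <= 1 ->
     is_derive h (1 : R) (f ^~ t) (g h t)) ->
  (forall h t : R, - e <= h <= e -> 0 <= t <= 1 -> {for t, continuous (f h)}) ->
  (forall h t : R, - e <= h <= e -> 0 <= t <= 1 ->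
     {for (h, t), continuous (fun z : R * R => g z.1 z.2)}) ->
  is_derive (0 : R) (1 : R) (fun h => \int[mu]_(t in `[0, 1]) f h t)
    (\int[mu]_(t in `[0, 1]) g 0 t).
Proof.
move=> e0 df cf cg.
have [M [Mr HM]] : bounded_set ((fun z : R * R => g z.1 z.2) @`
    (`[- e, e]%classic `*` `[0, 1]%classic)).
  apply: compact_bounded; apply: continuous_compact; last first.
    by apply: compact_setX; exact: segment_compact.
  apply: continuous_in_subspaceT => -[h t] /set_mem/= [].
  by rewrite /= !in_itv/=; exact: cg.
have ub (h t : R) : h \in `](- e), e[ -> 0 <= t <= 1 -> `|g h t| <= M + 1.
  rewrite in_itv/= => /andP[h1 h2] t01; apply: HM; first by rewrite ltrDl.
  by exists (h, t) => //; split; rewrite /= in_itv//= !ltW.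
have dfE (h t : R) : h \in `](- e), e[ -> 0 <= t <= 1 -> is_derive h (1 : R) (f ^~ t) (g h t).
  by rewrite in_itv/= => /andP[h1 h2] t01; apply: df => //; rewrite !ltW.
have intcst (c : R) : mu.-integrable `[0, 1] (EFin \o cst c).
  apply: continuous_compact_integrable; first exact: segment_compact.
  by apply: continuous_subspaceT; exact: cst_continuous.
have e00 : 0 \in `](- e), e[ by rewrite in_itv/= oppr_lt0 e0.
(* The maximum with 0 makes the dominating function visibly nonnegative. *)
have /= cv := @cvg_differentiation_under_integral R _ _ mu f `[0, 1] _ 0 (- e) e e00
  _ _ (cst (Num.max 0 (M + 1))) _ _ _.
have {cv} : h^-1 *: (\int[mu]_(t in `[0, 1]) f (h + 0) t - \int[mu]_(t in `[0, 1]) f 0 t)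
    @[h --> 0^'] --> \int[mu]_(t in `[0, 1]) g 0 t.
  rewrite (_ : (\int[mu]_(t in `[0, 1]) g 0 t) =
      \int[mu]_(y in `[0, 1]) (partial1of2 f) 0 y); last first.
    apply: eq_Rintegral => t /set_mem/=; rewrite in_itv/= => t01.
    by rewrite partial1of2E; have [_ ->] := dfE 0 t e00 t01.
  apply: cv => //=.
  - move=> h h1; apply: continuous_compact_integrable; first exact: segment_compact.
    apply: continuous_in_subspaceT => t /set_mem/=; rewrite in_itv/= => t01.
    by apply: cf => //; move: h1; rewrite in_itv/= => /andP[h1 h2]; rewrite !ltW.
  - by move=> h t h1; rewrite in_itv/= => t01; have [] := dfE h t h1 t01.
  - by move=> _; rewrite le_max lexx.
  - move=> h t h1; rewrite in_itv/= => t01.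
    rewrite partial1of2E; have [_ ->] := dfE h t h1 t01.
    by rewrite le_max ub// orbT.
move=> cv.
have eqf : (fun h : R => h^-1 *: (((fun h => \int[mu]_(t in `[0, 1]) f h t) \o shift 0) (h *: 1)
   - \int[mu]_(t in `[0, 1]) f 0 t)) = (fun h : R => h^-1 *:
   (\int[mu]_(t in `[0, 1]) f (h + 0) t - \int[mu]_(t in `[0, 1]) f 0 t)).
  by apply/funext => h /=; rewrite [h *: 1]mulr1.
split; first by rewrite /derivable eqf; apply/cvg_ex; eexists; exact: cv.
by rewrite /derive eqf; apply/cvg_lim.
Qed.

Lemma Rintegral_FTC01 (F f : R -> R) :
  (forall t : R, 0 <= t <= 1 -> is_derive t (1 : R) F (f t)) ->
  (forall t : R, 0 <= t <= 1 -> {for t, continuous f}) ->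
  \int[mu]_(t in `[0, 1]) f t = F 1 - F 0.
Proof.
move=> dF cf.
have cF (t : R) : 0 <= t <= 1 -> {for t, continuous F}.
  move=> t01; apply: differentiable_continuous; apply/derivable1_diffP.
  by have [] := dF t t01.
rewrite /Rintegral (@continuous_FTC2 _ f F) ?ltr01//.
- apply: continuous_in_subspaceT => t /set_mem/=; rewrite in_itv/=; exact: cf.
- split.
  + by move=> t; rewrite in_itv/= => /andP[t0 t1]; have [] := dF t; rewrite ?ltW.
  + by apply: cvg_at_right_filter; apply: cF; rewrite lexx ler01.
  + by apply: cvg_at_left_filter; apply: cF; rewrite lexx ler01.
- move=> t; rewrite in_itv/= => /andP[t0 t1].
  have t01 : 0 <= t <= 1 by rewrite !ltW.
  by rewrite derive1E; have [_ ->] := dF t t01.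
Qed.

End Leibniz.

Section SegmentIntegral.
Variables (R : realType) (E : normedModType R).
Local Notation mu := (@lebesgue_measure R).

Lemma deriveZv (f : E -> R) (x v : E) (t : R) : differentiable f x ->
  'D_(t *: v) f x = t * 'D_v f x.
Proof. by move=> df; rewrite !deriveE// linearZ. Qed.

Variables (w0 : E) (r : R) (omega : E -> E -> R).
Local Notation B := (ball w0 r).
Hypothesis lin_omega : forall x u v a,
  omega x (u + a *: v) = omega x u + a * omega x v.
Hypothesis C1_omega : forall u, Ck 1 B (omega ^~ u).
Hypothesis closed_omega : forall x u v, B x ->
  'D_v (omega ^~ u) x = 'D_u (omega ^~ v) x.

(** The homotopy operator of the Poincare lemma. *)
Definition segment_integral (w : E) : R :=
  \int[mu]_(t in `[0, 1]) omega (w0 + t *: (w - w0)) (w - w0).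

Lemma ball_segment (w : E) (t : R) : B w -> 0 <= t <= 1 ->
  B (w0 + t *: (w - w0)).
Proof.
rewrite -ball_normE/= => Bw /andP[t0 t1].
rewrite opprD addNKr normrN normrZ ger0_norm//.
by apply: le_lt_trans Bw; rewrite distrC ler_piMl.
Qed.

(** With u = w - w0 and z t = w0 + t u, differentiating the integrand along v
gives t D_v(omega u)(z t) + omega (z t) v, which by closedness is t D_u(omega
v)(z t) + omega (z t) v, the derivative of t |-> t omega (z t) v. Its integral
over [0, 1] is omega w v. *)
Lemma is_derive_segment_integral (w v : E) : B w ->
  is_derive w v segment_integral (omega w v).
Proof.
move=> Bw; pose u := w - w0.
pose z (h t : R) := w0 + t *: (u + h *: v).
have [e e0 Be] : exists2 e : R, 0 < e & forall h : R, - e <= h <= e -> B (w + h *: v).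
  have /nbhs_ballP[d /= d0 dB] : nbhs w B.
    exact: open_nbhs_nbhs (conj (ball_open _ _) Bw).
  exists (d / (`|v| + 1)); first by rewrite divr_gt0// ltr_wpDl.
  move=> h; rewrite -ler_norml => hd; apply: dB; rewrite -ball_normE/=.
  rewrite opprD addNKr normrN normrZ.
  apply: (@le_lt_trans _ _ (d / (`|v| + 1) * `|v|)); first by rewrite ler_wpM2r.
  by rewrite mulrAC ltr_pdivrMr ?ltr_wpDl// ltr_pM2l// ltrDl.
have Bz h t : - e <= h <= e -> 0 <= t <= 1 -> B (z h t).
  move=> he t01; have := ball_segment (Be h he) t01.
  by rewrite /z /u addrAC.
have dom a x : B x -> differentiable (omega ^~ a) x by have [+ _] := C1_omega a; apply.
have com a x : B x -> {for x, continuous (omega ^~ a)}.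
  by move=> Bx; exact: C1_continuous (C1_omega a) Bx.
have cdom a b x : B x -> {for x, continuous ('D_b (omega ^~ a))}.
  by move=> Bx; have [_ +] := C1_omega a; apply.
have cz h t : {for (h, t), continuous (fun y : R * R => z y.1 y.2)}.
  rewrite /z; apply: cvgD; first exact: cvg_cst.
  apply: cvgZ; first exact: cvg_snd.
  apply: cvgD; first exact: cvg_cst.
  by apply: cvgZ; [exact: cvg_fst|exact: cvg_cst].
have czt h t : {for t, continuous (z h)}.
  rewrite /z; apply: cvgD; first exact: cvg_cst.
  by apply: cvgZ; [exact: cvg_id|exact: cvg_cst].
have cct (k : E -> R) (h t : R) : {for z h t, continuous k} ->
    {for t, continuous (fun s => k (z h s))}.
  by move=> ck; apply: (continuous_comp (czt h t)).
have dzh a h t : - e <= h <= e -> 0 <= t <= 1 ->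
    is_derive h (1 : R) (fun h => omega (z h t) a) (t * 'D_v (omega ^~ a) (z h t)).
  move=> he t01; have zE k : z k t = (w0 + t *: u) + k *: (t *: v).
    by rewrite /z scalerDr addrA !scalerA mulrC.
  have d := dom a _ (Bz h t he t01); rewrite -deriveZv//.
  have -> : (fun h => omega (z h t) a) = (fun k => omega ((w0 + t *: u) + k *: (t *: v)) a).
    by apply/funext => k; rewrite zE.
  rewrite zE; apply: (@is_derive_line _ _ (omega ^~ a)).
  by apply: diff_derivable; rewrite -zE.
(* The integrand of the segment integral at w + h v, and its h-derivative. *)
pose f h t := omega (z h t) u + h * omega (z h t) v.
pose g h t := t * 'D_v (omega ^~ u) (z h t) +
   (omega (z h t) v + h * (t * 'D_v (omega ^~ v) (z h t))).
have dF : is_derive (0 : R) (1 : R) (fun h => \int[mu]_(t in `[0, 1]) f h t)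
    (\int[mu]_(t in `[0, 1]) g 0 t).
  apply: (derive_Rintegral e0) => h t he t01.
  - rewrite /f /g; apply: is_deriveD; first exact: dzh.
    apply: is_derive_eq; first exact: (is_deriveM (is_derive_id _ _) (dzh v h t he t01)).
    by rewrite addrC [_ *: 1]mulr1.
  - rewrite /f; apply: cvgD.
      by apply: (cct (omega ^~ u)); apply: com; exact: Bz.
    apply: cvgM; first exact: cvg_cst.
    by apply: (cct (omega ^~ v)); apply: com; exact: Bz.
  - have cc (k : E -> R) : {for z h t, continuous k} ->
        {for (h, t), continuous (fun y : R * R => k (z y.1 y.2))}.
      by move=> ck; apply: (continuous_comp (cz h t)).
    rewrite /g; apply: cvgD.
      by apply: cvgM; [exact: cvg_snd|apply: (cc ('D_v (omega ^~ u))); apply: cdom; exact: Bz].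
    apply: cvgD; first by apply: (cc (omega ^~ v)); apply: com; exact: Bz.
    apply: cvgM; first exact: cvg_fst.
    by apply: cvgM; [exact: cvg_snd|apply: (cc ('D_v (omega ^~ v))); apply: cdom; exact: Bz].
have intg : \int[mu]_(t in `[0, 1]) g 0 t = omega w v.
  have h00 : - e <= 0 <= e by rewrite oppr_le0 ltW.
  have z0 t : z 0 t = w0 + t *: u by rewrite /z scale0r addr0.
  transitivity (1 * omega (w0 + (1 : R) *: u) v - 0 * omega (w0 + (0 : R) *: u) v).
    2: by rewrite scale1r mul1r mul0r subr0 /u addrC subrK.
  apply: (@Rintegral_FTC01 R (fun t => t * omega (w0 + t *: u) v) (g 0)).
  - move=> t t01; have Bt := Bz 0 t h00 t01.
    apply: is_derive_eq.
      apply: (is_deriveM (is_derive_id _ _)).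
      apply: (@is_derive_line _ _ (omega ^~ v)); rewrite -z0.
      by apply: diff_derivable; exact: dom.
    by rewrite /g z0 closed_omega -?z0// mul0r addr0 [_ *: 1]mulr1.
  - move=> t t01; have Bt := Bz 0 t h00 t01.
    apply: cvgD.
      apply: cvgM; first exact: cvg_id.
      by apply: (cct ('D_v (omega ^~ u))); apply: cdom.
    apply: cvgD; first by apply: (cct (omega ^~ v)); apply: com.
    rewrite (_ : (fun _ => _) = cst 0); first by rewrite mul0r; exact: cvg_cst.
    by apply/funext => s; rewrite mul0r.
have fE h : \int[mu]_(t in `[0, 1]) f h t = segment_integral (h *: v + w).
  apply: eq_Rintegral => t _.
  by rewrite /f -lin_omega /z /u [h *: v + w]addrC [w + _ - w0]addrAC.
rewrite intg in dF; have [df1 df2] := dF.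
have eqf : (fun h : R => h^-1 *: (((fun h => \int[mu]_(t in `[0, 1]) f h t) \o shift 0) (h *: 1)
   - \int[mu]_(t in `[0, 1]) f 0 t)) = (fun h : R => h^-1 *:
   ((segment_integral \o shift w) (h *: v) - segment_integral w)).
  apply/funext => h /=; rewrite !fE addr0 scale0r add0r.
  by rewrite [h *: 1]mulr1.
split; first by rewrite /derivable -eqf.
by rewrite -df2 /derive eqf.
Qed.

End SegmentIntegral.

Section Poincare.
Variables (R : realType) (n : nat).
Local Notation E := 'cV[R]_n.

Lemma ler_coord_norm (v : E) i : `|v i 0| <= `|v|.
Proof.
rewrite [leRHS]/Num.Def.normr/= mx_normrE.
exact: (le_bigmax _ (fun ij : 'I_n * 'I_1 => `|v ij.1 ij.2|) (i, 0)).
Qed.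

(** The mean value theorem on the segment from x to x + h writes the increment
of f as the sum of the h_k A_k at a single intermediate point; the continuity of
the A_k makes the error o(h). *)
Lemma differentiable_partial (D : set E) (f : E -> R) (A : 'I_n -> E -> R) x :
  open D -> D x -> (forall k, {for x, continuous (A k)}) ->
  (forall y v, D y -> is_derive y v f (\sum_k v k 0 * A k y)) ->
  differentiable f x.
Proof.
move=> oD Dx cA df; pose L (v : E) : R := \sum_k v k 0 * A k x.
have linL : linear L.
  move=> a u v; rewrite /L /GRing.scale/= mulr_sumr -big_split/=.
  by apply: eq_bigr => k _; rewrite !mxE; ring.
pose Lm := GRing.isLinear.Build _ _ _ _ _ linL.
pose Ll : {linear E -> R} := HB.pack L Lm.
have cL : continuous Ll.
  suff : continuous L by [].
  apply: (continuous_big (op := +%R)) => [|k _]; first exact: add_continuous.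
  by move=> v; apply: (cvgM (@coord_continuous _ _ _ k 0 v)); exact: cvg_cst.
apply: (differentiable_approx cL) => _/posnumP[e].
(* n.+1 rather than n, so that the bound makes sense in dimension 0. *)
have d0 : 0 < e%:num / n.+1%:R by rewrite divr_gt0.
have nA : \forall y \near x, D y /\ forall k, `|A k x - A k y| < e%:num / n.+1%:R.
  apply: filterI; first exact: open_nbhs_nbhs (conj oD Dx).
  apply: (@filter_forall E 'I_n (fun k y => `|A k x - A k y| < e%:num / n.+1%:R)
    (nbhs x) (nbhs_filter x)) => k.
  by have /cvgrPdist_lt/(_ _ d0) := cA k.
move/nbhs_ballP : nA => [d /= d_gt0 dA].
apply/nbhs_ballP; exists d => // h; rewrite -ball_normE/= sub0r normrN => hd.
have seg (s : R) : 0 <= s <= 1 -> ball x d (x + s *: h).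
  move=> /andP[s0 s1]; rewrite -ball_normE/= opprD addNKr normrN normrZ ger0_norm//.
  by apply: le_lt_trans hd; rewrite ler_piMl.
have [|s s01] := @MVT_line _ _ f x h 1 ltr01.
  by move=> s /seg /dA [Ds _]; have [] := df _ h Ds.
have [Ds As] := dA _ (seg s s01); have [_ ->] := df _ h Ds.
rewrite scale1r mul1r opprD addrA [h + x]addrC => ->.
rewrite /L -sumrB; apply: (le_trans (ler_norm_sum _ _ _)).
apply: (@le_trans _ _ (\sum_(k < n) `|h| * (e%:num / n.+1%:R))).
  apply: ler_sum => k _; rewrite -mulrBr normrM ler_pM// ?ler_coord_norm//.
  by rewrite distrC ltW.
rewrite sumr_const card_ord -mulrnAr mulrC ler_wpM2r//.
rewrite -[_ *+ n]mulr_natr mulrAC ler_pdivrMr// ler_wpM2l//.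
by rewrite ler_nat.
Qed.

Lemma poincare (w0 : E) (r : R) (A : 'I_n -> E -> R) :
  (forall k, Ck 1 (ball w0 r) (A k)) ->
  (forall x j k, ball w0 r x ->
     'D_(delta_mx j 0) (A k) x = 'D_(delta_mx k 0) (A j) x) ->
  exists Y : E -> R, forall x, ball w0 r x -> differentiable Y x /\
    forall v, 'D_v Y x = \sum_k v k 0 * A k x.
Proof.
move=> CA closedA.
pose omega (x v : E) : R := \sum_k v k 0 * A k x.
have dA k x : ball w0 r x -> differentiable (A k) x by move=> ?; apply: (CA k).1.
have oB : open (ball w0 r) by exact: ball_open.
have Domega (x u v : E) : ball w0 r x ->
    'D_v (omega ^~ u) x = \sum_k \sum_j u k 0 * v j 0 * 'D_(delta_mx j 0) (A k) x.
  move=> Bx; rewrite /omega.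
  rewrite (_ : (fun _ => _) = \sum_(k < n) (fun x => u k 0 * A k x)); last first.
    by apply/funext => y; rewrite fct_sumE.
  rewrite derive_sum; last first.
    by move=> k; apply: derivableM => //; apply: diff_derivable; exact: dA.
  apply: eq_bigr => k _; rewrite deriveMl; last exact/diff_derivable/dA.
  rewrite (derive_coord v (dA k x Bx)) mulr_sumr; apply: eq_bigr => j _.
  by rewrite mulrA.
have dY w v : ball w0 r w -> is_derive w v (segment_integral w0 omega) (omega w v).
  apply: is_derive_segment_integral => //.
  - move=> x u v' a; rewrite /omega mulr_sumr -big_split/=.
    by apply: eq_bigr => k _; rewrite !mxE; ring.
  - move=> u; apply: C1_sum; first exact: oB.
    move=> k; exact (@C1M _ _ _ (fun=> u k 0) (A k) oB (C1_cst _ _) (CA k)).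
  - move=> x u v' Bx; rewrite !Domega// exchange_big/=; apply: eq_bigr => j _.
    by apply: eq_bigr => k _; rewrite closedA// [u _ _ * _]mulrC.
exists (segment_integral w0 omega) => x Bx; split; last first.
  by move=> v; have [] := dY x v Bx.
apply: (@differentiable_partial (ball w0 r) _ A x oB Bx) => k.
exact: C1_continuous (CA k) Bx.
Qed.

End Poincare.

(** * Vectors and matrices of dimension 3 *)

Lemma sum3 (V : nmodType) (F : 'I_3 -> V) :
  \sum_i F i = F 0 + F 1 + F 2%:R.
Proof.
rewrite !big_ord_recl big_ord0 addr0 addrA.
by congr (F _ + F _ + F _); exact: val_inj.
Qed.

Lemma I3_ind (P : 'I_3 -> Prop) : P 0 -> P 1 -> P 2%:R -> forall i, P i.
Proof.
move=> P0 P1 P2 [[|[|[|//]]] Hi].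
- by rewrite (_ : Ordinal Hi = 0)//; exact: val_inj.
- by rewrite (_ : Ordinal Hi = 1)//; exact: val_inj.
- by rewrite (_ : Ordinal Hi = 2%:R)//; exact: val_inj.
Qed.

Section Vectors.
Variable R : realType.
Local Notation E := 'cV[R]_3.
Implicit Types (u v w n : E) (M : 'M[R]_3).

Lemma det3 M : \det M =
  M 0 0 * (M 1 1 * M 2%:R 2%:R - M 1 2%:R * M 2%:R 1)
  - M 0 1 * (M 1 0 * M 2%:R 2%:R - M 1 2%:R * M 2%:R 0)
  + M 0 2%:R * (M 1 0 * M 2%:R 1 - M 1 1 * M 2%:R 0).
Proof.
(* Entries indexed by numbers, so that the indices of the minors compute. *)
pose a (i j : nat) := M (inord i) (inord j).
have ME i j : M i j = a i j by rewrite /a !inord_val.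
rewrite (expand_det_row _ 0) sum3 /cofactor !(expand_det_row _ 0).
rewrite !big_ord_recr !big_ord0 /cofactor !det_mx11 !mxE !ME /= !add0r.
rewrite /bump /=.
ring.
Qed.

Lemma cross0 u v : cross u v 0 0 = u 1 0 * v 2%:R 0 - u 2%:R 0 * v 1 0.
Proof. by rewrite mxE !add0r. Qed.

Lemma cross1 u v : cross u v 1 0 = u 2%:R 0 * v 0 0 - u 0 0 * v 2%:R 0.
Proof.
by rewrite mxE (_ : 1 + 1 = 2%:R :> 'I_3)// (_ : 1 + 2%:R = 0 :> 'I_3)//; exact: val_inj.
Qed.

Lemma cross2 u v : cross u v 2%:R 0 = u 0 0 * v 1 0 - u 1 0 * v 0 0.
Proof.
rewrite mxE (_ : 2%:R + 1 = 0 :> 'I_3); last exact: val_inj.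
by rewrite (_ : 2%:R + 2%:R = 1 :> 'I_3); last exact: val_inj.
Qed.

Definition cross3E := (cross0, cross1, cross2).

Lemma dot3 u v : dot u v = u 0 0 * v 0 0 + u 1 0 * v 1 0 + u 2%:R 0 * v 2%:R 0.
Proof. by rewrite /dot sum3. Qed.

Lemma dotC u v : dot u v = dot v u.
Proof. by rewrite !dot3; ring. Qed.

Lemma dotDr u v w : dot u (v + w) = dot u v + dot u w.
Proof. by rewrite !dot3 !mxE; ring. Qed.

Lemma dotZr u (a : R) v : dot u (a *: v) = a * dot u v.
Proof. by rewrite !dot3 !mxE; ring. Qed.

Lemma dotNr u v : dot u (- v) = - dot u v.
Proof. by rewrite -scaleN1r dotZr mulN1r. Qed.

Lemma dotBr u v w : dot u (v - w) = dot u v - dot u w.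
Proof. by rewrite dotDr dotNr. Qed.

Lemma dot0r u : dot u 0 = 0.
Proof. by rewrite -(scale0r u) dotZr mul0r. Qed.

Lemma dot_trmx (M : 'M[R]_3) u v : dot (M^T *m u) v = dot u (M *m v).
Proof. by rewrite !dot3 !mxE !sum3 !mxE; ring. Qed.

Lemma mulmx_col_ext (A B : 'M[R]_3) : (forall v : E, A *m v = B *m v) -> A = B.
Proof.
move=> AB; apply/matrixP => i j.
by have := congr1 (fun M : E => M i 0) (AB (delta_mx j 0)); rewrite -!colE !mxE.
Qed.

Lemma outerE u v i j : outer u v i j = u i 0 * v j 0.
Proof. by rewrite !mxE big_ord1 mxE. Qed.

Lemma mulmx_outer u v w : outer u v *m w = dot v w *: u.
Proof.
apply/matrixP => i j; rewrite !ord1 /outer -mulmxA !mxE big_ord1 mulrC; congr (_ * _).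
by rewrite mxE; apply: eq_bigr => k _; rewrite mxE.
Qed.

Lemma mulmx_outer4 (u1 u2 u3 u4 v1 v2 v3 v4 w : E) :
  (outer u1 v1 + outer u2 v2 + (outer u3 v3 + outer u4 v4)) *m w =
  dot v1 w *: u1 + dot v2 w *: u2 + (dot v3 w *: u3 + dot v4 w *: u4).
Proof. by rewrite !mulmxDl !mulmx_outer. Qed.

Lemma mulmx_crossmx u v : crossmx u *m v = cross u v.
Proof.
apply/matrixP => i j; rewrite !ord1 !mxE sum3 !mxE /=.
have [e20 e10 e21] : [/\ (2%:R == 0 :> 'I_3) = false, (1 == 0 :> 'I_3) = false &
  (2%:R == 1 :> 'I_3) = false] by [].
have [e02 e01 e12] : [/\ (0 == 2%:R :> 'I_3) = false, (0 == 1 :> 'I_3) = false &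
  (1 == 2%:R :> 'I_3) = false] by [].
have [a11 a12] : (1 + 1 = 2%:R :> 'I_3) /\ (1 + 2%:R = 0 :> 'I_3).
  by split; exact: val_inj.
have [a21 a22] : (2%:R + 1 = 0 :> 'I_3) /\ (2%:R + 2%:R = 1 :> 'I_3).
  by split; exact: val_inj.
move: i; apply: I3_ind; rewrite ?(add0r, a11, a12, a21, a22);
  rewrite ?(e20, e10, e21, e02, e01, e12) !eqxx /=; ring.
Qed.

Lemma dot_tproj n v : dot n n = 1 -> dot n (tproj n *m v) = 0.
Proof.
move=> nn; suff : (n^T *m (tproj n *m v)) 0 0 = 0.
  by rewrite mxE => <-; apply: eq_bigr => i _; rewrite !mxE.
have nTn : n^T *m n = 1%:M.
  apply/matrixP => i j; rewrite !ord1 !mxE eqxx -nn.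
  by apply: eq_bigr => k _; rewrite mxE.
by rewrite /tproj /outer mulmxA mulmxBr mulmx1 mulmxA nTn mul1mx subrr mul0mx mxE.
Qed.

Lemma tproj_orth n v : dot n v = 0 -> tproj n *m v = v.
Proof.
move=> nv; suff nTv : n^T *m v = 0.
  by rewrite /tproj /outer mulmxBl mul1mx -mulmxA nTv mulmx0 subr0.
apply/matrixP => i j; rewrite !ord1 !mxE -[RHS]nv.
by apply: eq_bigr => k _; rewrite mxE.
Qed.

Lemma tproj_normal (n : E) : dot n n = 1 -> tproj n *m n = 0.
Proof.
move=> nn; have nTn : n^T *m n = 1%:M.
  apply/matrixP => i j; rewrite !ord1 !mxE eqxx -nn.
  by apply: eq_bigr => k _; rewrite mxE.
by rewrite /tproj /outer mulmxBl mul1mx -mulmxA nTn mulmx1 subrr.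
Qed.

End Vectors.

(** * Orthonormal frames and rotations about the third vector *)

Section Frames.
Variable R : realType.
Local Notation E := 'cV[R]_3.
Implicit Types (u v w : E).

Section Frame.
Variables (n1 n2 n3 : E).
Hypothesis fr : pos_frame n1 n2 n3.
Local Notation Q := (\matrix_(i, j) [:: n1; n2; n3]`_j i 0 : 'M[R]_3).

Lemma frame_dot :
  [/\ dot n1 n1 = 1, dot n2 n2 = 1 & dot n3 n3 = 1] /\
  [/\ dot n1 n2 = 0, dot n1 n3 = 0 & dot n2 n3 = 0].
Proof.
have [QQ _] := fr.
have H i j : (Q^T *m Q) i j = dot ([:: n1; n2; n3]`_i) ([:: n1; n2; n3]`_j).
  by rewrite mxE; apply: eq_bigr => k _; rewrite !mxE.
rewrite QQ in H.
split; split.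
- by have := H 0 0; rewrite mxE.
- by have := H 1 1; rewrite mxE.
- by have := H 2%:R 2%:R; rewrite mxE.
- by have := H 0 1; rewrite mxE.
- by have := H 0 2%:R; rewrite mxE.
- by have := H 1 2%:R; rewrite mxE.
Qed.

Lemma frame_expand v : v = dot n1 v *: n1 + dot n2 v *: n2 + dot n3 v *: n3.
Proof.
have [/mulmx1C QQ _] := fr.
rewrite -[LHS]mul1mx -QQ -mulmxA.
apply/matrixP => i j; rewrite !ord1 !mxE sum3 !mxE /=.
rewrite (_ : dot n1 v = \sum_j Q^T 0 j * v j 0); last by apply: eq_bigr => k _; rewrite !mxE.
rewrite (_ : dot n2 v = \sum_j Q^T 1 j * v j 0); last by apply: eq_bigr => k _; rewrite !mxE.
rewrite (_ : dot n3 v = \sum_j Q^T 2%:R j * v j 0); last by apply: eq_bigr => k _; rewrite !mxE.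
by rewrite ![n1 _ _ * _]mulrC ![n2 _ _ * _]mulrC ![n3 _ _ * _]mulrC.
Qed.

Lemma frame_ext u v : dot n1 u = dot n1 v -> dot n2 u = dot n2 v ->
  dot n3 u = dot n3 v -> u = v.
Proof. by move=> h1 h2 h3; rewrite (frame_expand u) h1 h2 h3 -frame_expand. Qed.

(** The orientation enters here: the triple product of the frame is the
determinant of the matrix of its vectors. *)
Lemma frame_triple : dot n2 (cross n3 n1) = 1.
Proof.
have [_ <-] := fr; rewrite det3 dot3 !cross3E !mxE /=.
ring.
Qed.

Lemma frame_cross1 : cross n3 n1 = n2.
Proof.
have [[h11 h22 h33] [h12 h13 h23]] := frame_dot.
apply: frame_ext.
- by rewrite h12 dot3 !cross3E; ring.
- by rewrite frame_triple h22.
- by rewrite (dotC _ n2) h23 dot3 !cross3E; ring.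
Qed.

Lemma frame_cross2 : cross n3 n2 = - n1.
Proof.
have [[h11 h22 h33] [h12 h13 h23]] := frame_dot.
apply: frame_ext; rewrite dotNr.
- by rewrite h11 -frame_triple !dot3 !cross3E; ring.
- by rewrite (dotC _ n1) h12 dot3 !cross3E; ring.
- by rewrite (dotC _ n1) h13 dot3 !cross3E; ring.
Qed.

Lemma rotmx_frame1 a : rotmx n3 a *m n1 = cos a *: n1 + sin a *: n2.
Proof.
have [[h11 h22 h33] [h12 h13 h23]] := frame_dot.
rewrite /rotmx mulmxBl mulmxDl mul1mx -!scalemxAl mulmx_crossmx frame_cross1.
rewrite tproj_orth; last by rewrite dotC.
by rewrite scalerBl scale1r opprB addrC addrA subrK.
Qed.

Lemma rotmx_frame2 a : rotmx n3 a *m n2 = cos a *: n2 - sin a *: n1.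
Proof.
have [[h11 h22 h33] [h12 h13 h23]] := frame_dot.
rewrite /rotmx mulmxBl mulmxDl mul1mx -!scalemxAl mulmx_crossmx frame_cross2.
rewrite tproj_orth; last by rewrite dotC.
by rewrite scalerBl scale1r opprB scalerN addrC addrA subrK.
Qed.

Lemma rotmx_frame3 a : rotmx n3 a *m n3 = n3.
Proof.
have [[h11 h22 h33] [h12 h13 h23]] := frame_dot.
rewrite /rotmx mulmxBl mulmxDl mul1mx -!scalemxAl mulmx_crossmx tproj_normal//.
rewrite scaler0 subr0 (_ : cross n3 n3 = 0) ?scaler0 ?addr0//.
by apply/matrixP => i j; rewrite !ord1 !mxE mulrC subrr.
Qed.

End Frame.

Lemma tr_crossmx (n : E) : (crossmx n)^T = - crossmx n.
Proof.
have [a11 a12] : (1 + 1 = 2%:R :> 'I_3) /\ (1 + 2%:R = 0 :> 'I_3).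
  by split; exact: val_inj.
have [a21 a22] : (2%:R + 1 = 0 :> 'I_3) /\ (2%:R + 2%:R = 1 :> 'I_3).
  by split; exact: val_inj.
apply/matrixP => i j; rewrite !mxE.
move: i j; apply: I3_ind; apply: I3_ind; rewrite ?(add0r, a11, a12, a21, a22) /=; ring.
Qed.

Lemma tr_rotmx (n : E) (t : R) : (rotmx n t)^T = rotmx n (- t).
Proof.
rewrite /rotmx sinN cosN /tproj /outer.
rewrite !(linearB, linearD, linearZ)/= tr_scalar_mx tr_crossmx trmx_mul trmxK.
by rewrite scalerN scaleNr.
Qed.

Lemma mul_rotmxN (n1 n2 n3 : E) (t : R) : pos_frame n1 n2 n3 ->
  rotmx n3 (- t) *m rotmx n3 t = 1%:M.
Proof.
move=> fr; apply: mulmx_col_ext => v; rewrite mul1mx -mulmxA.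
rewrite (frame_expand fr v) !mulmxDr -!scalemxAr.
rewrite !(rotmx_frame1 fr, rotmx_frame2 fr, rotmx_frame3 fr).
rewrite mulmxBr !mulmxDr -!scalemxAr !(rotmx_frame1 fr, rotmx_frame2 fr, rotmx_frame3 fr).
rewrite sinN cosN; congr (_ *: _ + _ *: _ + _).
- apply/matrixP => i j; rewrite !mxE.
  transitivity ((cos t ^+ 2 + sin t ^+ 2) * n1 i j); first by ring.
  by rewrite cos2Dsin2 mul1r.
- apply/matrixP => i j; rewrite !mxE.
  transitivity ((cos t ^+ 2 + sin t ^+ 2) * n2 i j); first by ring.
  by rewrite cos2Dsin2 mul1r.
Qed.

(** The determinant is read off from the image of the frame, of which the first
two vectors are turned by t. *)
Lemma rotmx_rotation (n1 n2 n3 : E) (t : R) : pos_frame n1 n2 n3 ->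
  is_rotation (rotmx n3 t).
Proof.
move=> fr; split; first by rewrite tr_rotmx (mul_rotmxN t fr).
pose Q (u v w : E) : 'M[R]_3 := \matrix_(i, j) [:: u; v; w]`_j i 0.
have QM M u v w : M *m Q u v w = Q (M *m u) (M *m v) (M *m w).
  apply/matrixP => i j; rewrite !mxE.
  by move: j; apply: I3_ind; rewrite /= !mxE; apply: eq_bigr => k _; rewrite !mxE.
have [_ dQ] := fr; rewrite -[LHS]mulr1 -{1}dQ -det_mulmx -/(Q n1 n2 n3) QM.
rewrite (rotmx_frame1 fr) (rotmx_frame2 fr) (rotmx_frame3 fr).
transitivity ((cos t ^+ 2 + sin t ^+ 2) * \det (Q n1 n2 n3)).
  by rewrite !det3 !mxE /=; ring.
by rewrite cos2Dsin2 mul1r.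
Qed.

(** An alternating bilinear map on R^3 is determined by its values on the three
pairs of distinct frame vectors. *)
Lemma alternating_frame (n1 n2 n3 : E) (B : E -> E -> E) : pos_frame n1 n2 n3 ->
  (forall u v w, B (u + v) w = B u w + B v w) ->
  (forall (a : R) u w, B (a *: u) w = a *: B u w) ->
  (forall u v, B u v = - B v u) ->
  B n1 n2 = 0 -> B n1 n3 = 0 -> B n2 n3 = 0 -> forall u v, B u v = 0.
Proof.
move=> fr BD BZ BN h12 h13 h23 u v.
have Bd w : B w w = 0.
  apply/eqP; rewrite -[_ == 0]/(B w w == 0).
  have /eqP := BN w w; rewrite -addr_eq0 -mulr2n -scaler_nat scaler_eq0.
  by rewrite pnatr_eq0.
have Bx w : B n1 w = 0 -> B n2 w = 0 -> B n3 w = 0 -> B u w = 0.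
  by move=> h1 h2 h3; rewrite (frame_expand fr u) !BD !BZ h1 h2 h3 !scaler0 !addr0.
rewrite BN (frame_expand fr v) !BD !BZ !(BN _ u).
rewrite !Bx ?oppr0 ?scaler0 ?addr0 ?oppr0// BN ?h12 ?h13 ?h23 ?oppr0//.
Qed.

(** Here X_i and Y_i stand for the derivatives of n1 and n2 along n_i, da_i for
those of a1 and a2 along n2, and db_i for those of b1 and b2 along n1. Then B is
d_2 a - d_1 b - c1 a - c2 b for a = a1 n1 + a2 n2 and b = b1 n1 - b2 n2; its
component along n3 is k1 b1 - k2 a2. *)
Lemma frame_curl (n1 n2 n3 X1 X2 Y1 Y2 : E)
    (k1 k2 l C Z c1 c2 a1 a2 b1 b2 da1 da2 db1 db2 : R) : pos_frame n1 n2 n3 ->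
  a1 = l * k1 * C -> a2 = l * k1 * Z -> b1 = l * k2 * Z -> b2 = l * k2 * C ->
  dot n1 X1 = 0 -> dot n1 X2 = 0 -> dot n2 X1 = c1 -> dot n2 X2 = c2 ->
  dot n3 X1 = - k1 -> dot n3 X2 = 0 ->
  dot n1 Y1 = - c1 -> dot n1 Y2 = - c2 -> dot n2 Y1 = 0 -> dot n2 Y2 = 0 ->
  dot n3 Y1 = 0 -> dot n3 Y2 = - k2 ->
  let B := da1 *: n1 + a1 *: X2 + (da2 *: n2 + a2 *: Y2) - c2 *: (b1 *: n1 - b2 *: n2)
    - (c1 *: (a1 *: n1 + a2 *: n2) +
       (db1 *: n1 + b1 *: X1 - (db2 *: n2 + b2 *: Y1))) in
  [/\ dot n1 B = da1 - db1 - l * (k1 + k2) * (C * c1 + Z * c2),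
      dot n2 B = da2 + db2 - l * (k1 + k2) * (Z * c1 - C * c2) & dot n3 B = 0].
Proof.
move=> fr -> -> -> -> x11 x12 x21 x22 x31 x32 y11 y12 y21 y22 y31 y32 B.
have [[h11 h22 h33] [h12 h13 h23]] := frame_dot fr.
split; rewrite /B !(dotBr, dotDr, dotZr).
- by rewrite h11 h12 x11 x12 y11 y12; ring.
- by rewrite (dotC n2 n1) h12 h22 x21 x22 y21 y22; ring.
- by rewrite (dotC n3 n1) (dotC n3 n2) h13 h23 x31 x32 y31 y32; ring.
Qed.

End Frames.

(** * Tangent vectors of a surface *)

Section Surface.
Variable R : realType.
Local Notation E := 'cV[R]_3.
Implicit Types (S : set E) (nu : E -> E) (p u v : E).

Lemma deriveDZ (V : normedModType R) (f : E -> V) p u v (a : R) :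
  differentiable f p -> 'D_(u + a *: v) f p = 'D_u f p + a *: 'D_v f p.
Proof. by move=> df; rewrite !deriveE// linearD linearZ. Qed.

Lemma smooth_C1 (F V : normedModType R) (D : set F) (f : F -> V) :
  smooth D f -> Ck 1 D f.
Proof. exact. Qed.

Lemma smooth_differentiable (F V : normedModType R) (D : set F) (f : F -> V) x :
  smooth D f -> D x -> differentiable f x.
Proof. by move=> /smooth_C1[+ _]; apply. Qed.

Lemma smooth_derive_C1 (F V : normedModType R) (D : set F) (f : F -> V) (v : F) :
  smooth D f -> Ck 1 D ('D_v f).
Proof. by move=> /(_ 2)[_]; apply. Qed.

Lemma is_derive_curve (V : normedModType R) (g : E -> V) p v (gamma : R -> E) :
  gamma 0 = p -> is_derive (0 : R) (1 : R) gamma v -> differentiable g p ->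
  is_derive (0 : R) (1 : R) (g \o gamma) ('D_v g p).
Proof.
move=> g0 [dg dgE] df; have dgam : differentiable gamma 0 by apply/derivable1_diffP.
have dgg : differentiable g (gamma 0) by rewrite g0.
split; first by apply: diff_derivable; exact: differentiable_comp.
by rewrite (derive_comp _ dgam dgg) dgE g0.
Qed.

(** Both extensions agree with f along a curve on S with velocity v. *)
Lemma derive_extension_eq (V : normedModType R) S (f g h : E -> V) p v :
  is_extension S f p g -> is_extension S f p h -> tangent S p v ->
  'D_v g p = 'D_v h p.
Proof.
move=> [dg gf] [dh hf] [gamma [g0 gS dgam]].
have [_ <-] := is_derive_curve g0 dgam dg.
have [_ <-] := is_derive_curve g0 dgam dh.
apply: near_eq_derive.
have cgam : {for (0 : R), continuous gamma}.
  by apply: differentiable_continuous; apply/derivable1_diffP; have [] := dgam.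
have : \forall t \near (0 : R), S (gamma t) -> g (gamma t) = h (gamma t).
  apply: (cgam (fun x => S x -> g x = h x)); rewrite g0.
  by apply: filterS2 gf hf => x gx hx Sx; rewrite gx// hx.
by apply: filterS2 gS => t St; apply.
Qed.

Section Chart.
Variables (S D : set E) (Phi Psi : E -> E).
Hypotheses (oD : open D) (oW : open (Phi @` D)).
Hypotheses (sPhi : smooth D Phi) (sPsi : smooth (Phi @` D) Psi).
Hypothesis PhiK : forall x, D x -> Psi (Phi x) = x.
Hypothesis SPhi : forall x, D x -> (S x <-> Phi x ord_max 0 = 0).

Lemma derive_chartK p v : D p -> 'D_('D_v Phi p) Psi (Phi p) = v.
Proof.
move=> Dp; have dPhi := smooth_differentiable sPhi Dp.
have dPsi : differentiable Psi (Phi p) by apply: (smooth_differentiable sPsi); exists p.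
rewrite -(derive_comp _ dPhi dPsi) -[RHS](derive_id p v).
apply: near_eq_derive.
by apply: filterS (open_nbhs_nbhs (conj oD Dp)) => x Dx /=; rewrite PhiK.
Qed.

Lemma chart_inverse_surface (w : E) : (Phi @` D) w -> w ord_max 0 = 0 -> S (Psi w).
Proof. by move=> [x Dx <-] x0; rewrite PhiK//; apply/SPhi. Qed.

(** The curve is the image under Psi of a segment of the plane x_3 = 0. *)
Lemma tangent_chart_inverse (w a : E) : (Phi @` D) w -> w ord_max 0 = 0 ->
  a ord_max 0 = 0 -> tangent S (Psi w) ('D_a Psi w).
Proof.
move=> Ww w0 a0; exists (fun t : R => Psi (w + t *: a)); split.
- by rewrite scale0r addr0.
- have cl : {for (0 : R), continuous (fun t : R => w + t *: a)}.
    by apply: cvgD; [exact: cvg_cst|apply: cvgZ; [exact: cvg_id|exact: cvg_cst]].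
  have : \forall t \near (0 : R), (Phi @` D) (w + t *: a).
    apply: (cl (Phi @` D)); rewrite scale0r addr0.
    exact: open_nbhs_nbhs (conj oW Ww).
  apply: filterS => t Wt; apply: chart_inverse_surface => //.
  by rewrite !mxE w0 a0 mulr0 addr0.
- have dPsi := smooth_differentiable sPsi Ww.
  have eqf : (fun h : R => h^-1 *: (((fun t : R => Psi (w + t *: a)) \o shift 0) (h *: 1)
      - Psi (w + 0 *: a))) = (fun h : R => h^-1 *: ((Psi \o shift w) (h *: a) - Psi w)).
    apply/funext => h /=; rewrite [h *: 1]mulr1 addr0 scale0r addr0.
    by rewrite [w + _]addrC.
  by split; [rewrite /derivable eqf; exact: diff_derivable|rewrite /derive eqf].
Qed.

(** The third coordinate of Phi extends the zero function of S. *)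
Lemma derive_chart_tangent p v : D p -> S p -> tangent S p v ->
  ('D_v Phi p) ord_max 0 = 0.
Proof.
move=> Dp Sp tv; have dPhi := smooth_differentiable sPhi Dp.
rewrite derive_mxE//.
rewrite -[RHS](derive_cst (0 : R) p v).
apply: (derive_extension_eq (S := S) (f := fun=> 0 : R)) tv; split.
- exact: (differentiable_mxP Phi p).1 dPhi ord_max 0.
- apply: filterS (open_nbhs_nbhs (conj oD Dp)) => x Dx Sx.
  exact: (SPhi Dx).1.
- exact: differentiable_cst.
- by apply: filterS (open_nbhs_nbhs (conj oD Dp)) => x _ _.
Qed.

(** If the image of v under DPhi had a nonzero third coordinate, n could be
corrected by a multiple of v into a vector n - c v whose image lies in the plane
x_3 = 0. This vector is tangent, hence orthogonal to n, as v is by assumption: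
then n . n = 0. *)
Lemma orth_tangent_chart n p v : D p -> S p -> dot n n != 0 ->
  (forall u, tangent S p u -> dot n u = 0) -> dot n v = 0 -> tangent S p v.
Proof.
move=> Dp Sp n0 nT nv; have Wp : (Phi @` D) (Phi p) by exists p.
have Pp0 : Phi p ord_max 0 = 0 by apply: (SPhi Dp).1.
have dPsi := smooth_differentiable sPsi Wp.
have [w0|w0] := eqVneq (('D_v Phi p) ord_max 0) 0.
  by have := tangent_chart_inverse Wp Pp0 w0; rewrite PhiK// derive_chartK.
suff /eqP : dot n n = 0 by rewrite (negPf n0).
pose c := ('D_n Phi p) ord_max 0 / ('D_v Phi p) ord_max 0.
have c0 : ('D_n Phi p + (- c) *: 'D_v Phi p) ord_max 0 = 0.
  by rewrite 2!mxE /c mulNr divfK// subrr.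
have := tangent_chart_inverse Wp Pp0 c0.
rewrite PhiK// deriveDZ// !derive_chartK// scaleNr => /nT.
by rewrite dotBr dotZr nv mulr0 subr0.
Qed.

End Chart.

Lemma orth_tangent S nu p v : smooth_surface S -> unit_normal S nu -> S p ->
  dot (nu p) v = 0 -> tangent S p v.
Proof.
move=> hS [_ hnu] Sp nv; have [nn nT] := hnu p Sp.
have [D [Phi [Psi [[oD Dp oW] sPhi sPsi PhiK SPhi]]]] := hS p Sp.
apply: (orth_tangent_chart oD oW sPhi sPsi PhiK SPhi (n := nu p)) => //.
by rewrite nn oner_neq0.
Qed.

(** * The surface gradient through extensions *)

(** An extension g exists, so the one that sder picks is an extension too, and
the projected direction is tangent. *)
Lemma sderE (V : normedModType R) S nu (f g : E -> V) p v :
  smooth_surface S -> unit_normal S nu -> S p -> is_extension S f p g ->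
  sder S nu f p v = 'D_(tproj (nu p) *m v) g p.
Proof.
move=> hS hnu Sp gf.
have hf : is_extension S f p (extension S f p).
  by apply: (@getPex _ (is_extension S f p)); exists g.
rewrite /sder -deriveE; last by case: hf.
apply: (derive_extension_eq hf gf); apply: (orth_tangent hS hnu Sp).
by apply: dot_tproj; have [_ /(_ p Sp)[]] := hnu.
Qed.

(** Near a point of U, the extensions of f off S and off the intersection of S
with U are the same functions. *)
Lemma sder_setI (V : normedModType R) S U nu (f : E -> V) p v :
  open U -> U p -> sder (S `&` U) nu f p v = sder S nu f p v.
Proof.
move=> oU Up; rewrite /sder; suff -> : extension (S `&` U) f p = extension S f p by [].
rewrite /extension; congr (get _); apply/funext => g; apply/propext.
split=> -[dg gf]; split=> //; last by apply: filterS gf => x fx [/fx].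
by apply: filterS2 (open_nbhs_nbhs (conj oU Up)) gf => x Ux fx Sx; exact: fx.
Qed.

Lemma sder_sum (V : normedModType R) S nu (f : E -> V) p v :
  sder S nu f p v = \sum_k v k 0 *: sder S nu f p (delta_mx k 0).
Proof.
rewrite /sder {1}(matrix_sum_delta v) linear_sum linear_sum/=.
by apply: eq_bigr => k _; rewrite big_ord1 -scalemxAr linearZ.
Qed.

Lemma sder_normal (V : normedModType R) S nu (f : E -> V) p :
  dot (nu p) (nu p) = 1 -> sder S nu f p (nu p) = 0.
Proof. by move=> nn; rewrite /sder tproj_normal// linear0. Qed.

Lemma sgrad0_dot S nu (f : E -> R) p v :
  dot (sgrad0 S nu f p) v = sder (V := R^o) S nu f p v.
Proof.
by rewrite sder_sum /dot; apply: eq_bigr => k _; rewrite mxE mulrC.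
Qed.

Lemma sgrad1_mul S nu (f : E -> E) p v : sgrad1 S nu f p *m v = sder S nu f p v.
Proof.
rewrite [RHS]sder_sum; apply/matrixP => i j; rewrite !ord1 mxE summxE.
by apply: eq_bigr => k _; rewrite !mxE mulrC.
Qed.

Lemma sgrad2_mul S nu (f : E -> 'M[R]_3) p v i j :
  \sum_k sgrad2 S nu f p i j k * v k 0 = (sder S nu f p v) i j.
Proof.
rewrite [in RHS]sder_sum summxE.
by apply: eq_bigr => k _; rewrite !mxE mulrC.
Qed.

Lemma local_extension (V : normedModType R) S (D : set E) (f g : E -> V) p :
  open D -> D p -> differentiable g p -> (forall x, D x -> S x -> g x = f x) ->
  is_extension S f p g.
Proof.
move=> oD Dp dg gf; split=> //.
by apply: filterS (open_nbhs_nbhs (conj oD Dp)) => x; exact: gf.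
Qed.

(** The skew part in the last two legs, contracted with arbitrary vectors u and
v instead of the basis vectors. *)
Lemma skw_contract S nu (f : E -> 'M[R]_3) (M : 'M[R]_3) (n : E) p :
  skw (sgrad2 S nu f p) = skw (outer21 M n) <->
  forall u v, sder S nu f p v *m u - sder S nu f p u *m v =
    dot n v *: (M *m u) - dot n u *: (M *m v).
Proof.
split=> [H u v|H].
  apply/matrixP => i j; rewrite !ord1 !mxE !sum3 -!sgrad2_mul !sum3 !dot3.
  have Hs k l : sgrad2 S nu f p i k l =
      sgrad2 S nu f p i l k + M i k * n l 0 - M i l * n k 0.
    have := congr1 (fun T => T i k l) H; rewrite /skw /outer21.
    have h2 : (2^-1 : R) != 0 by rewrite invr_eq0 pnatr_eq0.
    by move/(mulfI h2) => h; rewrite -addrA -h addrC subrK.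
  by rewrite (Hs 0 1) (Hs 0 2%:R) (Hs 1 2%:R); ring.
apply/funext => i; apply/funext => j; apply/funext => k; rewrite /skw /outer21.
have dote l : dot n (delta_mx l 0) = n l 0.
  rewrite /dot (bigD1 l)//= !mxE !eqxx mulr1 big1 ?addr0// => i' /negPf il.
  by rewrite mxE il mulr0.
have := congr1 (fun T : E => T i 0) (H (delta_mx j 0) (delta_mx k 0)).
rewrite -!colE !dote !mxE /sgrad2 => ->.
by rewrite ![n _ _ * _]mulrC.
Qed.

Lemma derive_mul (f g : E -> R) p v : differentiable f p -> differentiable g p ->
  'D_v (fun x => f x * g x) p = 'D_v f p * g p + f p * 'D_v g p.
Proof.
move=> df dg; rewrite deriveM; try exact: diff_derivable.
rewrite addrC; congr (_ + _); exact: (mulrC (g p : R)).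
Qed.

Lemma differentiable_scale (s : E -> R) (f : E -> E) p :
  differentiable s p -> differentiable f p -> differentiable (fun x => s x *: f x) p.
Proof.
move=> ds df; apply/differentiable_mxP => i j; rewrite ord1.
rewrite (_ : (fun _ => _) = fun x => s x * f x i 0); last first.
  by apply/funext => x; rewrite mxE.
by apply: differentiableM => //; exact: (differentiable_mxP f p).1 df i 0.
Qed.

Lemma derive_scale (s : E -> R) (f : E -> E) p v :
  differentiable s p -> differentiable f p ->
  'D_v (fun x => s x *: f x) p = 'D_v s p *: f p + s p *: 'D_v f p.
Proof.
move=> ds df; have dfi i := (differentiable_mxP f p).1 df i 0.
apply/matrixP => i j; rewrite ord1 derive_mxE; last exact: differentiable_scale.
rewrite (_ : (fun _ => _) = (fun x => s x * f x i 0)); last first.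
  by apply/funext => x; rewrite mxE.
rewrite derive_mul// !mxE derive_mxE//.
Qed.

Lemma differentiable_outer (f g : E -> E) p :
  differentiable f p -> differentiable g p ->
  differentiable (fun x => outer (f x) (g x)) p.
Proof.
move=> df dg; apply/differentiable_mxP => i j.
rewrite (_ : (fun _ => _) = fun x => f x i 0 * g x j 0); last first.
  by apply/funext => x; rewrite outerE.
apply: differentiableM; first exact: (differentiable_mxP f p).1 df i 0.
exact: (differentiable_mxP g p).1 dg j 0.
Qed.

Lemma derive_outer (f g : E -> E) p v :
  differentiable f p -> differentiable g p ->
  'D_v (fun x => outer (f x) (g x)) p =
  outer ('D_v f p) (g p) + outer (f p) ('D_v g p).
Proof.
move=> df dg; have dfi i := (differentiable_mxP f p).1 df i 0.
have dgi i := (differentiable_mxP g p).1 dg i 0.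
apply/matrixP => i j; rewrite derive_mxE; last exact: differentiable_outer.
rewrite (_ : (fun _ => _) = (fun x => f x i 0 * g x j 0)); last first.
  by apply/funext => x; rewrite outerE.
by rewrite derive_mul// [RHS]mxE !outerE !derive_mxE.
Qed.

Lemma derive_dot (f g : E -> E) p v : differentiable f p -> differentiable g p ->
  'D_v (fun x => dot (f x) (g x)) p = dot ('D_v f p) (g p) + dot (f p) ('D_v g p).
Proof.
move=> df dg.
have dfi i := (differentiable_mxP f p).1 df i 0.
have dgi i := (differentiable_mxP g p).1 dg i 0.
rewrite /dot (_ : (fun _ => _) = \sum_(i < 3) (fun x => f x i 0 * g x i 0)); last first.
  by apply/funext => x; rewrite fct_sumE.
rewrite derive_sum; last by move=> i; apply: derivableM; exact: diff_derivable.
rewrite -big_split/=; apply: eq_bigr => i _.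
by rewrite derive_mul// !derive_mxE.
Qed.

(** Differentiate the constant f . g along the surface. *)
Lemma dot_derive_antisym S (D : set E) (f g : E -> E) p v (a : R) : open D -> D p ->
  differentiable f p -> differentiable g p ->
  (forall x, D x -> S x -> dot (f x) (g x) = a) -> tangent S p v ->
  dot (g p) ('D_v f p) = - dot (f p) ('D_v g p).
Proof.
move=> oD Dp df dg fga tv; apply/eqP; rewrite -addr_eq0 dotC -derive_dot//.
rewrite -(derive_cst (a : R) p v); apply/eqP.
apply: (derive_extension_eq (S := S) (f := fun=> a : R)) tv.
  apply: (local_extension oD Dp); last by move=> x Dx Sx; exact: fga.
  rewrite /dot (_ : (fun _ => _) = \sum_(i < 3) (fun x => f x i 0 * g x i 0)); last first.
    by apply/funext => x; rewrite fct_sumE.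
  apply: differentiable_sum => i; apply: differentiableM.
    exact: (differentiable_mxP f p).1 df i 0.
  exact: (differentiable_mxP g p).1 dg i 0.
by apply: (local_extension oD Dp) => //; exact: differentiable_cst.
Qed.

End Surface.

(** * The integrability condition as a system for the stretch and the angle *)

Definition neutral_stretch (R : realType) (n1 n2 : 'cV[R]_3 -> 'cV[R]_3)
    (k1 k2 lam : 'cV[R]_3 -> R) p : 'M[R]_3 :=
  lam p *: (k1 p *: outer (n1 p) (n1 p) - k2 p *: outer (n2 p) (n2 p)).

Definition neutral_gradient (R : realType) (nu n1 n2 : 'cV[R]_3 -> 'cV[R]_3)
    (k1 k2 lam alpha : 'cV[R]_3 -> R) p : 'M[R]_3 :=
  rotmx (nu p) (alpha p) *m neutral_stretch n1 n2 k1 k2 lam p.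

Section NeutralGradient.
Variable R : realType.
Local Notation E := 'cV[R]_3.
Variables (S : set E) (nu n1 n2 : E -> E) (k1 k2 lam alpha : E -> R).
Hypotheses (hS : smooth_surface S) (hnu : unit_normal S nu).
Hypotheses (hn1 : smooth_field S n1) (hn2 : smooth_field S n2).
Hypothesis hframe : forall p, S p -> pos_frame (n1 p) (n2 p) (nu p).
Hypothesis hcurv : forall p, S p -> sgrad1 S nu nu p =
  k1 p *: outer (n1 p) (n1 p) + k2 p *: outer (n2 p) (n2 p).
Hypothesis hlam : Ck_field (V := R^o) 1 S lam.
Hypothesis halpha : Ck_field (V := R^o) 1 S alpha.
Local Notation U := (neutral_stretch n1 n2 k1 k2 lam).
Local Notation F := (neutral_gradient nu n1 n2 k1 k2 lam alpha).
Local Notation c := (fun p => (sgrad1 S nu n1 p)^T *m n2 p).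

Lemma curvature_mul1 p : S p -> sgrad1 S nu nu p *m n1 p = k1 p *: n1 p.
Proof.
move=> Sp; have [[h11 _ _] [h12 _ _]] := frame_dot (hframe Sp).
rewrite hcurv// mulmxDl -!scalemxAl !mulmx_outer h11 (dotC (n2 p)) h12.
by rewrite scale1r scale0r scaler0 addr0.
Qed.

Lemma curvature_mul2 p : S p -> sgrad1 S nu nu p *m n2 p = k2 p *: n2 p.
Proof.
move=> Sp; have [[_ h22 _] [h12 _ _]] := frame_dot (hframe Sp).
rewrite hcurv// mulmxDl -!scalemxAl !mulmx_outer h22 h12.
by rewrite scale1r scale0r scaler0 add0r.
Qed.

Lemma neutral_stretch_mul p v : U p *m v =
  lam p *: (k1 p *: (dot (n1 p) v *: n1 p) - k2 p *: (dot (n2 p) v *: n2 p)).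
Proof.
rewrite /neutral_stretch -scalemxAl mulmxBl.
rewrite -!scalemxAl.
by rewrite !mulmx_outer.
Qed.

Lemma neutral_gradient_mul1 p : S p -> F p *m n1 p =
  (lam p * k1 p * cos (alpha p)) *: n1 p + (lam p * k1 p * sin (alpha p)) *: n2 p.
Proof.
move=> Sp; have fr := hframe Sp; have [[h11 _ _] [h12 _ _]] := frame_dot fr.
rewrite /neutral_gradient -mulmxA neutral_stretch_mul h11 (dotC (n2 p)) h12.
rewrite scale1r scale0r scaler0 subr0 -!scalemxAr (rotmx_frame1 fr).
by rewrite !scalerDr !scalerA.
Qed.

Lemma neutral_gradient_mul2 p : S p -> F p *m n2 p =
  (lam p * k2 p * sin (alpha p)) *: n1 p + (- (lam p * k2 p * cos (alpha p))) *: n2 p.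
Proof.
move=> Sp; have fr := hframe Sp; have [[_ h22 _] [h12 _ _]] := frame_dot fr.
rewrite /neutral_gradient -mulmxA neutral_stretch_mul h22 h12.
rewrite scale1r scale0r scaler0 sub0r -!scalemxAr mulmxN -scalemxAr (rotmx_frame2 fr).
by apply/matrixP => i j; rewrite !mxE; ring.
Qed.

Lemma neutral_gradient_mul3 p : S p -> F p *m nu p = 0.
Proof.
move=> Sp; have fr := hframe Sp; have [_ [_ h13 h23]] := frame_dot fr.
rewrite /neutral_gradient -mulmxA neutral_stretch_mul h13 h23.
by rewrite !scale0r !scaler0 subr0 scaler0 mulmx0.
Qed.

Lemma neutral_gradient_frame p : S p -> F p =
  outer (F p *m n1 p) (n1 p) + outer (F p *m n2 p) (n2 p).
Proof.
move=> Sp; apply: mulmx_col_ext => v; rewrite mulmxDl !mulmx_outer.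
rewrite {1}(frame_expand (hframe Sp) v) !mulmxDr -!scalemxAr.
by rewrite neutral_gradient_mul3// scaler0 addr0.
Qed.

Lemma neutral_polar p : S p -> k2 p < 0 < k1 p -> 0 < lam p ->
  polar_decomposition (nu p) (F p) (rotmx (nu p) (alpha p)) (U p).
Proof.
move=> Sp /andP[k20 k10] l0; have fr := hframe Sp.
have [_ [_ h13 h23]] := frame_dot fr.
split=> //.
- exact: rotmx_rotation fr.
- by apply/matrixP => i j; rewrite /neutral_stretch !mxE !big_ord1 !mxE; ring.
- by rewrite neutral_stretch_mul h13 h23 !scale0r !scaler0 subr0 scaler0.
- move=> v v0 nv; rewrite neutral_stretch_mul dotZr dotBr !dotZr.
  rewrite (dotC v (n1 p)) (dotC v (n2 p)) pmulr_rgt0// subr_gt0.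
  rewrite -!expr2; have [d1|d1] := eqVneq (dot (n1 p) v) 0.
    rewrite d1 expr0n mulr0 pmulr_llt0 ?k20// exprn_even_gt0//=.
    apply: contra_neq v0 => d2; apply: (frame_ext fr).
    - by rewrite d1 dot0r.
    - by rewrite d2 dot0r.
    - by rewrite nv dot0r.
  apply: (@le_lt_trans _ _ 0); first by rewrite mulr_le0_ge0 ?sqr_ge0// ltW.
  by rewrite mulr_gt0// exprn_even_gt0.
Qed.

(** The principal curvatures are only given through the curvature tensor. They
have C^1 extensions because k_i = n_i . (D nu) n_i, where nu, n1 and n2 extend
smoothly. *)
Lemma local_fields p : S p ->
  exists (D : set E) (N1 N2 N : E -> E) (K1 K2 L A : E -> R),
  [/\ open D, D p, [/\ Ck 1 D N1, Ck 1 D N2 & Ck 1 D N],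
      [/\ Ck 1 D K1, Ck 1 D K2, Ck 1 D L & Ck 1 D A] &
      forall x, D x -> S x -> [/\ N1 x = n1 x, N2 x = n2 x & N x = nu x] /\
        [/\ K1 x = k1 x, K2 x = k2 x, L x = lam x & A x = alpha x]].
Proof.
move=> Sp.
have [D1 [N1 [oD1 D1p sN1 eN1]]] := hn1 Sp.
have [D2 [N2 [oD2 D2p sN2 eN2]]] := hn2 Sp.
have [D3 [N [oD3 D3p sN eN]]] := hnu.1 p Sp.
have [D4 [L [oD4 D4p sL eL]]] := hlam Sp.
have [D5 [A [oD5 D5p sA eA]]] := halpha Sp.
pose D := D1 `&` D2 `&` D3 `&` D4 `&` D5.
have [s1 s2 s3 s4 s5] : [/\ D `<=` D1, D `<=` D2, D `<=` D3, D `<=` D4 & D `<=` D5].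
  by split=> x [[[[]]]].
have oD : open D by do !apply: openI.
(* The principal curvature in the direction M, read off from an extension of nu. *)
pose K (M : E -> E) (x : E) : R :=
  \sum_(i < 3) \sum_(j < 3) M x i 0 * (M x j 0 * ('D_(delta_mx j 0) N x) i 0).
have CK (M : E -> E) : Ck 1 D M -> Ck 1 D (K M).
  move=> CM; have CMi i := (C1_mxP M oD).1 CM i 0.
  apply: (C1_sum _ oD) => i; apply: (C1_sum _ oD) => j.
  apply: (C1M oD (CMi i)); apply: (C1M oD (CMi j)).
  apply: (C1_mxP _ oD).1; exact: Ck_sub s3 (smooth_derive_C1 _ sN).
have KE (M : E -> E) x (m : E) (k : R) : D x -> S x -> M x = m -> dot (nu x) m = 0 ->
    dot m m = 1 -> sgrad1 S nu nu x *m m = k *: m -> K M x = k.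
  move=> Dx Sx Mm nm mm km; rewrite -[RHS]mulr1 -mm -dotZr -km sgrad1_mul.
  have dN : differentiable N x by apply: (smooth_differentiable sN); exact: s3.
  have eN' : is_extension S nu x N by apply: (local_extension oD3 (s3 _ Dx)) => //.
  rewrite (sderE _ hS hnu Sx eN') tproj_orth// (derive_coord m dN).
  rewrite /K /dot Mm; apply: eq_bigr => i _; rewrite summxE mulr_sumr.
  by apply: eq_bigr => j _; rewrite mxE.
have C1 := Ck_sub s1 (smooth_C1 sN1); have C2 := Ck_sub s2 (smooth_C1 sN2).
exists D, N1, N2, N, (K N1), (K N2), L, A; split.
- exact: oD.
- by [].
- by split; [exact: C1|exact: C2|exact: Ck_sub s3 (smooth_C1 sN)].
- by split; [exact: CK|exact: CK|exact: Ck_sub s4 sL|exact: Ck_sub s5 sA].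
- move=> x Dx Sx; have [[h11 h22 _] [_ h13 h23]] := frame_dot (hframe Sx).
  rewrite (eN1 x (s1 _ Dx) Sx) (eN2 x (s2 _ Dx) Sx) (eN x (s3 _ Dx) Sx).
  rewrite (eL x (s4 _ Dx) Sx) (eA x (s5 _ Dx) Sx); split=> //; split=> //.
  + apply: (KE _ _ (n1 x)) => //; first exact: eN1 (s1 _ Dx) Sx.
      by rewrite dotC.
    exact: curvature_mul1.
  + apply: (KE _ _ (n2 x)) => //; first exact: eN2 (s2 _ Dx) Sx.
      by rewrite dotC.
    exact: curvature_mul2.
Qed.

Section LocalExtension.
Variables (D : set E) (N1 N2 N : E -> E) (K1 K2 L A : E -> R).
Hypotheses (oD : open D) (CN1 : Ck 1 D N1) (CN2 : Ck 1 D N2) (CN : Ck 1 D N).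
Hypotheses (CK1 : Ck 1 D K1) (CK2 : Ck 1 D K2) (CL : Ck 1 D L) (CA : Ck 1 D A).
Hypothesis extE : forall x, D x -> S x ->
  [/\ N1 x = n1 x, N2 x = n2 x & N x = nu x] /\
  [/\ K1 x = k1 x, K2 x = k2 x, L x = lam x & A x = alpha x].

Let a1 x := L x * K1 x * cos (A x).
Let a2 x := L x * K1 x * sin (A x).
Let b1 x := L x * K2 x * sin (A x).
Let b2 x := L x * K2 x * cos (A x).
Let a x := a1 x *: N1 x + a2 x *: N2 x.
Let b x := b1 x *: N1 x - b2 x *: N2 x.
Let G x := outer (a x) (N1 x) + outer (b x) (N2 x).

Let Ca1 : Ck 1 D a1.
Proof. exact: (C1M oD (C1M oD CL CK1) (C1_cos oD CA)). Qed.
Let Ca2 : Ck 1 D a2.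
Proof. exact: (C1M oD (C1M oD CL CK1) (C1_sin oD CA)). Qed.
Let Cb1 : Ck 1 D b1.
Proof. exact: (C1M oD (C1M oD CL CK2) (C1_sin oD CA)). Qed.
Let Cb2 : Ck 1 D b2.
Proof. exact: (C1M oD (C1M oD CL CK2) (C1_cos oD CA)). Qed.

Lemma ext_C1 : Ck 1 D G.
Proof.
have C1 i := (C1_mxP N1 oD).1 CN1 i 0; have C2 i := (C1_mxP N2 oD).1 CN2 i 0.
apply/(C1_mxP _ oD) => i j.
rewrite (_ : (fun _ => _) = fun x => (a1 x * N1 x i 0 + a2 x * N2 x i 0) * N1 x j 0 +
    (b1 x * N1 x i 0 + - (b2 x * N2 x i 0)) * N2 x j 0); last first.
  by apply/funext => x; rewrite /G mxE !outerE /a /b !mxE.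
apply: (C1D oD); apply: (C1M oD _ (C1 j)) || apply: (C1M oD _ (C2 j)).
  exact: (C1D oD (C1M oD Ca1 (C1 i)) (C1M oD Ca2 (C2 i))).
exact: (C1D oD (C1M oD Cb1 (C1 i)) (C1N oD (C1M oD Cb2 (C2 i)))).
Qed.

Lemma ext_eq x : D x -> S x -> G x = F x.
Proof.
move=> Dx Sx; have [[e1 e2 _] [e4 e5 e6 e7]] := extE Dx Sx.
rewrite [RHS]neutral_gradient_frame// neutral_gradient_mul1//.
rewrite neutral_gradient_mul2// /G /a /b /a1 /a2 /b1 /b2.
by rewrite e1 e2 e4 e5 e6 e7 scaleNr.
Qed.

Section AtPoint.
Variable p : E.
Hypotheses (Dp : D p) (Sp : S p).

Let fr := hframe Sp.
Let c1 := dot (n2 p) ('D_(n1 p) N1 p).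
Let c2 := dot (n2 p) ('D_(n2 p) N1 p).

Let N1p : N1 p = n1 p. Proof. by have [[]] := extE Dp Sp. Qed.
Let N2p : N2 p = n2 p. Proof. by have [[]] := extE Dp Sp. Qed.
Let dN1 : differentiable N1 p. Proof. exact: CN1.1. Qed.
Let dN2 : differentiable N2 p. Proof. exact: CN2.1. Qed.
Let dN : differentiable N p. Proof. exact: CN.1. Qed.
Let da1 : differentiable a1 p. Proof. exact: Ca1.1. Qed.
Let da2 : differentiable a2 p. Proof. exact: Ca2.1. Qed.
Let db1 : differentiable b1 p. Proof. exact: Cb1.1. Qed.
Let db2 : differentiable b2 p. Proof. exact: Cb2.1. Qed.

Lemma ext_tangent v : dot (nu p) v = 0 -> tangent S p v.
Proof. exact: orth_tangent hS hnu Sp. Qed.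

Lemma ext_sder (V : normedModType R) (f g : E -> V) v : differentiable g p ->
  (forall x, D x -> S x -> g x = f x) -> dot (nu p) v = 0 ->
  sder S nu f p v = 'D_v g p.
Proof.
move=> dg gf nv; rewrite (sderE _ hS hnu Sp (local_extension oD Dp dg gf)).
by rewrite tproj_orth.
Qed.

Let tv1 : dot (nu p) (n1 p) = 0.
Proof. by have [_ [_ h13 _]] := frame_dot fr; rewrite dotC. Qed.
Let tv2 : dot (nu p) (n2 p) = 0.
Proof. by have [_ [_ _ h23]] := frame_dot fr; rewrite dotC. Qed.

(** The Leibniz rule for G = a (x) N1 + b (x) N2, contracted with u in the
middle leg. *)
Lemma ext_F_sder u v : dot (nu p) v = 0 -> sder S nu F p v *m u =
  dot (n1 p) u *: ('D_v a1 p *: n1 p + a1 p *: 'D_v N1 p +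
                   ('D_v a2 p *: n2 p + a2 p *: 'D_v N2 p)) +
  dot ('D_v N1 p) u *: a p +
  (dot (n2 p) u *: ('D_v b1 p *: n1 p + b1 p *: 'D_v N1 p -
                   ('D_v b2 p *: n2 p + b2 p *: 'D_v N2 p)) +
  dot ('D_v N2 p) u *: b p).
Proof.
move=> nv; have dG : differentiable G p by exact: ext_C1.1.
rewrite (ext_sder dG ext_eq nv).
have s11 := differentiable_scale da1 dN1; have s22 := differentiable_scale da2 dN2.
have t11 := differentiable_scale db1 dN1; have t22 := differentiable_scale db2 dN2.
have da : differentiable a p by exact: differentiableD s11 s22.
have db : differentiable b p by exact: differentiableB t11 t22.
have -> : 'D_v G p = 'D_v (fun x => outer (a x) (N1 x)) p + 'D_v (fun x => outer (b x) (N2 x)) p.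
  by apply: deriveD; apply: diff_derivable; exact: differentiable_outer.
rewrite (derive_outer _ da dN1) (derive_outer _ db dN2).
rewrite mulmx_outer4 N1p N2p.
have -> : 'D_v a p = 'D_v a1 p *: n1 p + a1 p *: 'D_v N1 p +
                   ('D_v a2 p *: n2 p + a2 p *: 'D_v N2 p).
  rewrite -N1p -N2p -!derive_scale//.
  by apply: deriveD; exact: diff_derivable.
have -> // : 'D_v b p = 'D_v b1 p *: n1 p + b1 p *: 'D_v N1 p -
                   ('D_v b2 p *: n2 p + b2 p *: 'D_v N2 p).
rewrite -N1p -N2p -!derive_scale//.
by apply: deriveB; exact: diff_derivable.
Qed.

(** Derivatives of the relations n_i . n_j = delta_ij and n_i . nu = 0. *)
Lemma connection_coefs v : dot (nu p) v = 0 ->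
  [/\ dot (n1 p) ('D_v N1 p) = 0, dot (n2 p) ('D_v N2 p) = 0 &
      dot (n1 p) ('D_v N2 p) = - dot (n2 p) ('D_v N1 p)] /\
  [/\ dot (nu p) ('D_v N1 p) = - dot (n1 p) (sgrad1 S nu nu p *m v) &
      dot (nu p) ('D_v N2 p) = - dot (n2 p) (sgrad1 S nu nu p *m v)].
Proof.
move=> nv; have tv := ext_tangent nv.
have on (f g : E -> E) (f' g' : E -> E) (r : R) : differentiable f p -> differentiable g p ->
    (forall x, D x -> S x -> f x = f' x) -> (forall x, D x -> S x -> g x = g' x) ->
    (forall x, S x -> dot (f' x) (g' x) = r) ->
    dot (g' p) ('D_v f p) = - dot (f' p) ('D_v g p).
  move=> df dg ff gg fg; rewrite -ff// -gg//.
  by apply: (dot_derive_antisym oD Dp df dg _ tv) => x Dx Sx; rewrite ff// gg// fg.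
have e1 x : D x -> S x -> N1 x = n1 x by move=> Dx /(extE Dx)[[]].
have e2 x : D x -> S x -> N2 x = n2 x by move=> Dx /(extE Dx)[[]].
have e3 x : D x -> S x -> N x = nu x by move=> Dx /(extE Dx)[[]].
have half (x : R) : x = - x -> x = 0 by lra.
rewrite sgrad1_mul (ext_sder dN e3 nv); split; split.
- apply: half; apply: (on _ _ n1 n1 1 dN1 dN1 e1 e1) => x /hframe/frame_dot[[]] //.
- apply: half; apply: (on _ _ n2 n2 1 dN2 dN2 e2 e2) => x /hframe/frame_dot[[]] //.
- apply: (on _ _ n2 n1 0 dN2 dN1 e2 e1) => x /hframe/frame_dot[_ []] //.
  by rewrite dotC.
- by apply: (on _ _ n1 nu 0 dN1 dN e1 e3) => x /hframe/frame_dot[_ []].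
- by apply: (on _ _ n2 nu 0 dN2 dN e2 e3) => x /hframe/frame_dot[_ []].
Qed.

(** B is the difference of the two sides. On the pairs with nu, the derivative
along nu vanishes and [connection_coefs] turns nu . d n_i into curvatures, which match
the right hand side; on (n1, n2) the right hand side vanishes and [frame_curl]
applies. *)
Lemma ext_integrable_pde :
  (forall u v, sder S nu F p v *m u - sder S nu F p u *m v =
    dot (nu p) v *: ((F p *m sgrad1 S nu nu p) *m u) -
    dot (nu p) u *: ((F p *m sgrad1 S nu nu p) *m v)) <->
  'D_(n2 p) a1 p - 'D_(n1 p) b1 p =
    lam p * (k1 p + k2 p) * (cos (alpha p) * c1 + sin (alpha p) * c2) /\
  'D_(n2 p) a2 p + 'D_(n1 p) b2 p =
    lam p * (k1 p + k2 p) * (sin (alpha p) * c1 - cos (alpha p) * c2).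
Proof.
have [[h11 h22 h33] [h12 h13 h23]] := frame_dot fr.
have [[x11 y12 y11] [x13 y13]] := connection_coefs tv1.
have [[x21 y22 y21] [x23 y23]] := connection_coefs tv2.
rewrite -/c1 in y11; rewrite -/c2 in y21.
have Kn1 u : dot u (sgrad1 S nu nu p *m n1 p) = k1 p * dot u (n1 p).
  by rewrite curvature_mul1// dotZr.
have Kn2 u : dot u (sgrad1 S nu nu p *m n2 p) = k2 p * dot u (n2 p).
  by rewrite curvature_mul2// dotZr.
rewrite Kn1 h11 mulr1 in x13; rewrite Kn1 (dotC (n2 p) (n1 p)) h12 mulr0 oppr0 in y13.
rewrite Kn2 h22 mulr1 in y23; rewrite Kn2 h12 mulr0 oppr0 in x23.
have [[_ _ _] [e4 e5 e6 e7]] := extE Dp Sp.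
have a1E : a1 p = lam p * k1 p * cos (alpha p) by rewrite /a1 e4 e6 e7.
have a2E : a2 p = lam p * k1 p * sin (alpha p) by rewrite /a2 e4 e6 e7.
have b1E : b1 p = lam p * k2 p * sin (alpha p) by rewrite /b1 e5 e6 e7.
have b2E : b2 p = lam p * k2 p * cos (alpha p) by rewrite /b2 e5 e6 e7.
pose B u v := sder S nu F p v *m u - sder S nu F p u *m v -
    (dot (nu p) v *: ((F p *m sgrad1 S nu nu p) *m u) -
    dot (nu p) u *: ((F p *m sgrad1 S nu nu p) *m v)).
have s3 : sder S nu F p (nu p) = 0 by exact: sder_normal.
have aE : a p = F p *m n1 p by rewrite neutral_gradient_mul1// /a a1E a2E N1p N2p.
have bE : b p = F p *m n2 p by rewrite neutral_gradient_mul2// /b b1E b2E N1p N2p scaleNr.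
have B13 : B (n1 p) (nu p) = 0.
  rewrite /B s3 mul0mx sub0r (ext_F_sder _ tv1) h13 h23 !scale0r !add0r.
  rewrite !(dotC _ (nu p)) x13 y13 scale0r addr0 h33 tv1 scale0r subr0 scale1r.
  by rewrite -mulmxA curvature_mul1// -scalemxAr aE scaleNr opprK subrr.
have B23 : B (n2 p) (nu p) = 0.
  rewrite /B s3 mul0mx sub0r (ext_F_sder _ tv2) h13 h23 !scale0r !add0r.
  rewrite !(dotC _ (nu p)) x23 y23 scale0r add0r h33 tv2 scale0r subr0 scale1r.
  by rewrite -mulmxA curvature_mul2// -scalemxAr bE scaleNr opprK subrr.
have B12 : B (n1 p) (n2 p) =
  ('D_(n2 p) a1 p *: n1 p + a1 p *: 'D_(n2 p) N1 p +
   ('D_(n2 p) a2 p *: n2 p + a2 p *: 'D_(n2 p) N2 p)) - c2 *: b p -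
  (c1 *: a p + ('D_(n1 p) b1 p *: n1 p + b1 p *: 'D_(n1 p) N1 p -
                   ('D_(n1 p) b2 p *: n2 p + b2 p *: 'D_(n1 p) N2 p))).
  rewrite /B (ext_F_sder _ tv1) (ext_F_sder _ tv2) tv1 tv2 !scale0r subr0 subr0.
  rewrite h11 h22 (dotC (n2 p) (n1 p)) h12 !scale1r !scale0r !add0r.
  rewrite (dotC _ (n1 p)) x21 (dotC _ (n1 p)) y21 (dotC _ (n2 p)) -/c1.
  by rewrite (dotC _ (n2 p)) y12 !scale0r !addr0 scaleNr.
have B12E : B (n1 p) (n2 p) = 0 <->
    'D_(n2 p) a1 p - 'D_(n1 p) b1 p =
    lam p * (k1 p + k2 p) * (cos (alpha p) * c1 + sin (alpha p) * c2) /\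
    'D_(n2 p) a2 p + 'D_(n1 p) b2 p =
    lam p * (k1 p + k2 p) * (sin (alpha p) * c1 - cos (alpha p) * c2).
  have := frame_curl ('D_(n2 p) a1 p) ('D_(n2 p) a2 p) ('D_(n1 p) b1 p) ('D_(n1 p) b2 p)
    fr a1E a2E b1E b2E x11 x21 (erefl c1) (erefl c2) x13 x23 y11 y21 y12 y22 y13 y23.
  rewrite /= -[in X in X -> _]N1p -[in X in X -> _]N2p -/(a p) -/(b p) N1p N2p -B12.
  move=> [E1 E2 E3].
  split=> [B0|[P1 P2]].
    rewrite B0 dot0r in E1; rewrite B0 dot0r in E2.
    by split; apply/eqP; rewrite -subr_eq0 -?E1 -?E2.
  by apply: (frame_ext fr); rewrite dot0r ?E1 ?E2 ?E3// ?P1 ?P2 subrr.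
rewrite -B12E; split=> [H|B0 u v]; first by rewrite /B H subrr.
apply/eqP; rewrite -subr_eq0 -/(B u v); apply/eqP.
apply: (alternating_frame fr) => //.
- move=> u1 u2 w; rewrite /B !mulmxDr dotDr scalerDr scalerDl.
  rewrite (_ : sder S nu F p (u1 + u2) = sder S nu F p u1 + sder S nu F p u2).
    rewrite mulmxDl.
    by apply/matrixP => i j; rewrite !mxE; ring.
  by rewrite /sder mulmxDr linearD.
- move=> r u1 w; rewrite /B -!scalemxAr dotZr.
  rewrite (_ : sder S nu F p (r *: u1) = r *: sder S nu F p u1).
    rewrite -scalemxAl.
    by apply/matrixP => i j; rewrite !mxE; ring.
  by rewrite /sder -scalemxAr linearZ.
- move=> u1 u2; rewrite /B.
  by rewrite [RHS]opprB [in RHS]opprB [LHS]addrC opprB.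
Qed.

End AtPoint.

End LocalExtension.

Lemma local_gradient p : S p -> exists (D : set E) (G : E -> 'M[R]_3),
  [/\ open D, D p, Ck 1 D G & forall x, D x -> S x -> G x = F x].
Proof.
move=> Sp; have [D [N1 [N2 [N [K1 [K2 [L [A [oD Dp [C1 C2 C3] [C4 C5 C6 C7] ext]]]]]]]]] :=
  local_fields Sp.
exists D; eexists; split; [exact: oD|exact: Dp| |].
- exact: (ext_C1 oD C1 C2 C4 C5 C6 C7).
- exact: (ext_eq ext).
Qed.

Lemma connection_antisym p : S p -> c p = - ((sgrad1 S nu n2 p)^T *m n1 p).
Proof.
move=> Sp; have [D [N1 [N2 [N [K1 [K2 [L [A [oD Dp [C1 C2 C3] [C4 C5 C6 C7] ext]]]]]]]]] :=
  local_fields Sp.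
have [[_ _ nn] _] := frame_dot (hframe Sp).
suff cv v : dot v (c p) = dot v (- ((sgrad1 S nu n2 p)^T *m n1 p)).
  by apply: (frame_ext (hframe Sp)); exact: cv.
rewrite dotNr dotC dot_trmx sgrad1_mul.
rewrite [in RHS]dotC dot_trmx sgrad1_mul.
have e1 x : D x -> S x -> N1 x = n1 x by move=> Dx /(ext x Dx)[[]].
have e2 x : D x -> S x -> N2 x = n2 x by move=> Dx /(ext x Dx)[[]].
rewrite (sderE v hS hnu Sp (local_extension oD Dp (C1.1 p Dp) e1)).
rewrite (sderE v hS hnu Sp (local_extension oD Dp (C2.1 p Dp) e2)).
have [[_ _ ->] _] := connection_coefs oD C1 C2 C3 ext Dp Sp (dot_tproj v nn).
by rewrite opprK.
Qed.

Lemma integrable_iff_pde p : S p ->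
  skw (sgrad2 S nu F p) = skw (outer21 (F p *m sgrad1 S nu nu p) (nu p)) <->
  dot (sgrad0 S nu (fun q => lam q * k1 q * cos (alpha q)) p) (n2 p) -
  dot (sgrad0 S nu (fun q => lam q * k2 q * sin (alpha q)) p) (n1 p) =
  lam p * (k1 p + k2 p) *
    (cos (alpha p) * dot (c p) (n1 p) + sin (alpha p) * dot (c p) (n2 p))
  /\
  dot (sgrad0 S nu (fun q => lam q * k1 q * sin (alpha q)) p) (n2 p) +
  dot (sgrad0 S nu (fun q => lam q * k2 q * cos (alpha q)) p) (n1 p) =
  lam p * (k1 p + k2 p) *
    (sin (alpha p) * dot (c p) (n1 p) - cos (alpha p) * dot (c p) (n2 p)).
Proof.
move=> Sp; have [D [N1 [N2 [N [K1 [K2 [L [A [oD Dp [C1 C2 C3] [C4 C5 C6 C7] ext]]]]]]]]] :=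
  local_fields Sp.
have [_ [_ h13 h23]] := frame_dot (hframe Sp).
have t1 : dot (nu p) (n1 p) = 0 by rewrite dotC.
have t2 : dot (nu p) (n2 p) = 0 by rewrite dotC.
rewrite skw_contract.
have := ext_integrable_pde oD C1 C2 C3 C4 C5 C6 C7 ext Dp Sp.
have e1 x : D x -> S x -> N1 x = n1 x by move=> Dx /(ext x Dx)[[]].
rewrite !dot_trmx !sgrad1_mul.
rewrite !(ext_sder oD Dp Sp (C1.1 p Dp) e1)//.
have scal (f g : E -> R) v : Ck 1 D g -> (forall x, D x -> S x -> g x = f x) ->
    dot (nu p) v = 0 -> dot (sgrad0 S nu f p) v = 'D_v g p.
  move=> Cg gf nv; rewrite sgrad0_dot.
  exact: (ext_sder (V := R^o) oD Dp Sp (Cg.1 p Dp) gf nv).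
have E1 : dot (sgrad0 S nu (fun q => lam q * k1 q * cos (alpha q)) p) (n2 p) =
    'D_(n2 p) (fun x => L x * K1 x * cos (A x)) p.
  apply: scal t2; first exact: (C1M oD (C1M oD C6 C4) (C1_cos oD C7)).
  by move=> x Dx /(ext x Dx)[_ [-> _ -> ->]].
have E2 : dot (sgrad0 S nu (fun q => lam q * k1 q * sin (alpha q)) p) (n2 p) =
    'D_(n2 p) (fun x => L x * K1 x * sin (A x)) p.
  apply: scal t2; first exact: (C1M oD (C1M oD C6 C4) (C1_sin oD C7)).
  by move=> x Dx /(ext x Dx)[_ [-> _ -> ->]].
have E3 : dot (sgrad0 S nu (fun q => lam q * k2 q * cos (alpha q)) p) (n1 p) =
    'D_(n1 p) (fun x => L x * K2 x * cos (A x)) p.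
  apply: scal t1; first exact: (C1M oD (C1M oD C6 C5) (C1_cos oD C7)).
  by move=> x Dx /(ext x Dx)[_ [_ -> -> ->]].
have E4 : dot (sgrad0 S nu (fun q => lam q * k2 q * sin (alpha q)) p) (n1 p) =
    'D_(n1 p) (fun x => L x * K2 x * sin (A x)) p.
  apply: scal t1; first exact: (C1M oD (C1M oD C6 C5) (C1_sin oD C7)).
  by move=> x Dx /(ext x Dx)[_ [_ -> -> ->]].
have transport (X : Prop) (x y z t x' y' z' t' r s : R) : x = x' -> y = y' -> z = z' ->
    t = t' -> (X <-> x' - y' = r /\ z' + t' = s) -> (X <-> x - y = r /\ z + t = s).
  by move=> -> -> -> ->.
exact: (transport _ _ _ _ _ _ _ _ _ _ _ E1 E4 E2 E3).
Qed.

End NeutralGradient.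

(** * Local primitives of an integrable gradient *)

Section Flat.
Variable R : realType.
Local Notation E := 'cV[R]_3.

(** The projection onto the plane x_3 = 0 of an adapted chart. *)
Definition flat (w : E) : E := w - w ord_max 0 *: delta_mx ord_max 0.

Lemma flat_max w : flat w ord_max 0 = 0.
Proof. by rewrite /flat !mxE !eqxx mulr1 subrr. Qed.

Lemma flat_id (w : E) : w ord_max 0 = 0 -> flat w = w.
Proof. by move=> w0; rewrite /flat w0 scale0r subr0. Qed.

Lemma flat_sum w : flat w = \sum_k w k 0 *: flat (delta_mx k 0).
Proof.
have flatD u v : flat (u + v) = flat u + flat v.
  by rewrite /flat mxE scalerDl opprD addrACA.
have flatZ a u : flat (a *: u) = a *: flat u.
  by rewrite /flat mxE scalerBr scalerA.
have flat0 : flat 0 = 0 by rewrite /flat mxE scale0r subr0.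
rewrite {1}(matrix_sum_delta w) (big_morph flat flatD flat0).
by apply: eq_bigr => k _; rewrite big_ord1 flatZ.
Qed.

Lemma differentiable_entry (w : E) i : differentiable (fun x : E => x i 0) w.
Proof. exact: differentiable_coord. Qed.

Lemma derive_entry (w v : E) i : 'D_v (fun x : E => x i 0) w = v i 0.
Proof.
have := @derive_mxE R E 3 1 id w v i 0.
by rewrite derive_id => ->.
Qed.

Lemma C1_entry (D : set E) i : open D -> Ck 1 D (fun x : E => x i 0).
Proof.
move=> oD; apply: (C1_intro (V := R) (df := fun v _ : E => v i 0) oD).
- by move=> x _; exact: differentiable_entry.
- by move=> v x _; exact: derive_entry.
- by move=> v x _; exact: (@cst_continuous E R (v i 0) x).
Qed.

Lemma C1_flat (D : set E) : open D -> Ck 1 D flat.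
Proof.
move=> oD; apply/(C1_mxP _ oD) => i j; rewrite ord1.
have := C1D oD (C1_entry i oD)
  (C1N oD (C1M oD (C1_entry ord_max oD) (C1_cst _ ((delta_mx ord_max 0 : E) i 0)))).
by apply: C1_eq => // x _; rewrite [in RHS]mxE [in RHS]mxE [X in _ = _ - X]mxE.
Qed.

Lemma differentiable_flat w : differentiable flat w.
Proof. by have [+ _] := C1_flat openT; apply. Qed.

Lemma derive_flat w v : 'D_v flat w = flat v.
Proof.
apply/matrixP => i j; rewrite ord1 derive_mxE; last exact: differentiable_flat.
rewrite (_ : (fun _ => _) = (fun x : E => x i 0) -
    (fun x : E => x ord_max 0 * (delta_mx ord_max 0 : E) i 0)); last first.
  by apply/funext => x; rewrite /flat !mxE.
have d1 := differentiable_entry w i.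
have d2 := differentiable_entry w ord_max.
have dc : differentiable (fun=> (delta_mx ord_max 0 : E) i 0 : R) w by exact: differentiable_cst.
rewrite deriveB; [|exact: diff_derivable|by apply: diff_derivable; exact: differentiableM].
by rewrite derive_mul// derive_cst mulr0 addr0 !derive_entry /flat !mxE.
Qed.

End Flat.
Arguments flat {R} w.

Section LocalPrimitive.
Variable R : realType.
Local Notation E := 'cV[R]_3.
Variables (S : set E) (nu : E -> E) (F : E -> 'M[R]_3).
Hypotheses (hS : smooth_surface S) (hnu : unit_normal S nu).
Hypothesis F_C1 : forall p, S p -> exists (D : set E) (G : E -> 'M[R]_3),
  [/\ open D, D p, Ck 1 D G & forall x, D x -> S x -> G x = F x].
Hypothesis F_normal : forall p, S p -> F p *m nu p = 0.
Hypothesis F_sym : forall p u v, S p -> tangent S p u -> tangent S p v ->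
  sder S nu F p v *m u = sder S nu F p u *m v.

Section InChart.
Variables (D : set E) (Phi Psi : E -> E).
Hypotheses (oD : open D) (oW : open (Phi @` D)).
Hypotheses (sPhi : smooth D Phi) (sPsi : smooth (Phi @` D) Psi).
Hypothesis PhiK : forall x, D x -> Psi (Phi x) = x.
Hypothesis SPhi : forall x, D x -> (S x <-> Phi x ord_max 0 = 0).
Variables (D1 : set E) (G : E -> 'M[R]_3).
Hypotheses (oD1 : open D1) (CG : Ck 1 D1 G).
Hypothesis GF : forall x, D1 x -> S x -> G x = F x.
Variables (w0 : E) (r : R).
Local Notation B := (ball w0 r).
Hypothesis BW : forall w, B w -> (Phi @` D) (flat w).
Hypothesis BD1 : forall w, B w -> D1 (Psi (flat w)).

(** The coefficient of d w_k in the i-th row of F d(Psi o flat), with F extended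
by G. *)
Definition chart_coef (i k : 'I_3) (w : E) : R := \sum_j
  G (Psi (flat w)) i j * ('D_(flat (delta_mx k 0)) Psi (flat w)) j 0.

Let oB : open B. Proof. exact: ball_open. Qed.

Let CX : Ck 1 B (Psi \o flat).
Proof.
apply/(C1_mxP _ oB) => i j.
apply: (C1_comp (D' := Phi @` D) (f := fun y => Psi y i j) oB BW (C1_flat oB)).
exact: ((C1_mxP _ oW).1 (smooth_C1 sPsi)).
Qed.

Let CGX i j : Ck 1 B (fun w => G (Psi (flat w)) i j).
Proof.
apply: (C1_comp (D' := D1) (f := fun y => G y i j) oB BD1 CX).
exact: ((C1_mxP _ oD1).1 CG).
Qed.

Let CDPsi u j : Ck 1 B (fun w => ('D_u Psi (flat w)) j 0).
Proof.
apply: (C1_comp (D' := Phi @` D) (f := fun y => ('D_u Psi y) j 0) oB BW (C1_flat oB)).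
exact: ((C1_mxP _ oW).1 (smooth_derive_C1 u sPsi)).
Qed.

Lemma chart_coef_C1 i k : Ck 1 B (chart_coef i k).
Proof.
by apply: (C1_sum _ oB) => j; exact: (C1M oB (CGX i j) (CDPsi _ j)).
Qed.

Lemma derive_Psi_sym u v j y : (Phi @` D) y ->
  'D_v (fun y => ('D_u Psi y) j 0) y = 'D_u (fun y => ('D_v Psi y) j 0) y.
Proof.
move=> Wy; pose Pj (x : E) : R := Psi x j 0.
have dPsi x : (Phi @` D) x -> differentiable Psi x by exact: smooth_differentiable sPsi.
have PjE a x : (Phi @` D) x -> ('D_a Psi x) j 0 = 'D_a Pj x.
  by move=> Wx; rewrite derive_mxE//; exact: dPsi.
have CPj a : Ck 1 (Phi @` D) ('D_a Pj).
  apply: (C1_eq oW (PjE a)).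
  exact: ((C1_mxP _ oW).1 (smooth_derive_C1 a sPsi)).
have near_PjE a : \forall x \near y, ('D_a Psi x) j 0 = 'D_a Pj x.
  by apply: filterS (open_nbhs_nbhs (conj oW Wy)) => x; exact: PjE.
apply: (etrans (near_eq_derive v (near_PjE u))); apply/esym.
apply: (etrans (near_eq_derive u (near_PjE v))); apply/esym.
apply: (derive_sym oW Wy) => // x Wx.
exact: ((differentiable_mxP Psi x).1 (dPsi x Wx) j 0).
Qed.

(** Differentiating along e_l gives (DF(U_l) U_k)_i plus F applied to a second
derivative of Psi, where the U_k are the columns of D(Psi o flat). These are
tangent to S, so the first term is symmetric by the integrability of F; the
second one is symmetric because Psi is C^2. *)
Lemma chart_coef_closed (i : 'I_3) (w : E) (k l : 'I_3) : B w ->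
  'D_(delta_mx l 0) (chart_coef i k) w = 'D_(delta_mx k 0) (chart_coef i l) w.
Proof.
move=> Bw; have Wy := BW Bw; have D1x := BD1 Bw.
have dPsi : differentiable Psi (flat w) by exact: smooth_differentiable sPsi Wy.
have dG : differentiable G (Psi (flat w)) by exact: CG.1.
have Sx : S (Psi (flat w)) by apply: (chart_inverse_surface PhiK SPhi Wy); exact: flat_max.
(* Opaque names: U_m is the m-th column of D(Psi o flat), H holds the second
   derivatives of Psi. *)
have [U UE] : exists U : 'I_3 -> E, forall m, U m = 'D_(flat (delta_mx m 0)) Psi (flat w).
  by eexists.
have [H HE] : exists H : 'I_3 -> 'I_3 -> 'I_3 -> R, forall m n j, H m n j =
    'D_(flat (delta_mx n 0)) (fun y => ('D_(flat (delta_mx m 0)) Psi y) j 0) (flat w).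
  by eexists.
have [dGU dGUE] : exists dGU : 'I_3 -> 'M[R]_3, forall m,
    dGU m = 'D_(U m) G (Psi (flat w)) by eexists.
have DA (m n : 'I_3) : 'D_(delta_mx n 0) (chart_coef i m) w =
    (dGU n *m U m) i 0 + \sum_j G (Psi (flat w)) i j * H m n j.
  rewrite /chart_coef (_ : (fun _ => _) = \sum_(j < 3) (fun w => G (Psi (flat w)) i j *
      ('D_(flat (delta_mx m 0)) Psi (flat w)) j 0)); last first.
    by apply/funext => x; rewrite fct_sumE.
  have d1 j : differentiable (fun w => G (Psi (flat w)) i j) w by exact: (CGX i j).1.
  have d2 j : differentiable (fun w => ('D_(flat (delta_mx m 0)) Psi (flat w)) j 0) w.
    exact: (CDPsi _ j).1.
  rewrite derive_sum; last by move=> j; apply: diff_derivable; exact: differentiableM.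
  have e1 j : 'D_(delta_mx n 0) (fun w => G (Psi (flat w)) i j) w =
      dGU n i j.
    rewrite dGUE UE derive_mxE//.
    have := @derive_comp R E E R (fun y => G y i j) (Psi \o flat) w (delta_mx n 0).
    rewrite (derive_comp _ (differentiable_flat w) dPsi) derive_flat; apply.
      by apply: differentiable_comp; [exact: differentiable_flat|].
    exact: ((differentiable_mxP G _).1 dG i j).
  have e2 j : 'D_(delta_mx n 0) (fun w => ('D_(flat (delta_mx m 0)) Psi (flat w)) j 0) w = H m n j.
    rewrite HE.
    have := @derive_comp R E E R (fun y => ('D_(flat (delta_mx m 0)) Psi y) j 0) flat w (delta_mx n 0).
    rewrite derive_flat; apply; first exact: differentiable_flat.
    by apply: ((C1_mxP _ oW).1 (smooth_derive_C1 _ sPsi) j 0).1.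
  rewrite mxE -big_split; apply: eq_bigr => j _.
  by rewrite (derive_mul _ (d1 j) (d2 j)) e1 e2 UE.
have HS j : H k l j = H l k j by rewrite !HE; exact: derive_Psi_sym.
have tU m : tangent S (Psi (flat w)) (U m).
  by rewrite UE; apply: (tangent_chart_inverse oW sPsi PhiK SPhi Wy); exact: flat_max.
have GE m : dGU m = sder S nu F (Psi (flat w)) (U m).
  have nU : dot (nu (Psi (flat w))) (U m) = 0.
    by have [_ /(_ _ Sx)[_]] := hnu; apply; exact: tU.
  have := sderE (U m) hS hnu Sx (local_extension oD1 D1x dG GF).
  by rewrite (tproj_orth nU) dGUE => ->.
apply: (etrans (DA k l)); apply/esym; apply: (etrans (DA l k)).
rewrite !GE (F_sym Sx (tU k) (tU l)); congr (_ + _).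
by apply: eq_bigr => j _; rewrite HS.
Qed.

(** On a tangent vector t, the flattening acts trivially on DPhi(t), and DPsi
undoes DPhi. *)
Lemma chart_coef_tangent (i : 'I_3) q t : B (Phi q) -> D q -> S q -> tangent S q t ->
  \sum_k ('D_t Phi q) k 0 * chart_coef i k (Phi q) = (F q *m t) i 0.
Proof.
move=> Bq Dq Sq tt.
have fq : flat (Phi q) = Phi q by apply: flat_id; exact: (SPhi Dq).1.
have dPsi : differentiable Psi (Phi q) by apply: (smooth_differentiable sPsi); exists q.
have D1q : D1 q by have := BD1 Bq; rewrite fq PhiK.
have tE : t = \sum_k ('D_t Phi q) k 0 *: 'D_(flat (delta_mx k 0)) Psi (Phi q).
  rewrite -[LHS](derive_chartK oD sPhi sPsi PhiK t Dq).
  rewrite -{1}(flat_id (derive_chart_tangent oD sPhi SPhi Dq Sq tt)) flat_sum.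
  rewrite deriveE// linear_sum; apply: eq_bigr => k _.
  by rewrite linearZ -(deriveE _ dPsi).
rewrite [in RHS]tE mulmx_sumr summxE; apply: eq_bigr => k _.
rewrite -scalemxAr [RHS]mxE /chart_coef fq PhiK// GF//; congr (_ * _).
by rewrite [RHS]mxE.
Qed.

End InChart.

(** Primitives Y_i of the closed rows of F d(Psi o flat), pulled back by Phi. *)
Lemma local_primitive p : S p -> exists (V : set E) (y : E -> E),
  [/\ open V, V p, Ck 1 V y &
      forall q, S q -> V q -> sgrad1 (S `&` V) nu y q = F q].
Proof.
move=> Sp.
have [D [Phi [Psi [[oD Dp oW] sPhi sPsi PhiK SPhi]]]] := hS Sp.
have [D1 [G [oD1 D1p CG GF]]] := F_C1 Sp.
pose w0 := Phi p.
have Ww0 : (Phi @` D) w0 by exists p.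
have fw0 : flat w0 = w0 by apply: flat_id; exact: (SPhi _ Dp).1.
have [r r0 rB] : exists2 r : R, 0 < r & forall w, ball w0 r w ->
    (Phi @` D) (flat w) /\ D1 (Psi (flat w)).
  have cf : {for w0, continuous flat}.
    by apply: differentiable_continuous; exact: differentiable_flat.
  have cPsi : {for w0, continuous Psi}.
    by apply: differentiable_continuous; exact: smooth_differentiable sPsi Ww0.
  have nW : nbhs w0 (fun y => (Phi @` D) y /\ D1 (Psi y)).
    apply: filterI; first exact: open_nbhs_nbhs (conj oW Ww0).
    by apply: (cPsi D1); rewrite PhiK//; exact: open_nbhs_nbhs (conj oD1 D1p).
  have : nbhs w0 (fun w => (Phi @` D) (flat w) /\ D1 (Psi (flat w))).
    by apply: (cf (fun y => (Phi @` D) y /\ D1 (Psi y))); rewrite fw0.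
  by move=> /nbhs_ballP[r /= r0 rB]; exists r => // w /rB.
have BW w : ball w0 r w -> (Phi @` D) (flat w) by move=> /rB[].
have BD1 w : ball w0 r w -> D1 (Psi (flat w)) by move=> /rB[].
have CA i k : Ck 1 (ball w0 r) (chart_coef Psi G i k).
  exact: (chart_coef_C1 oW sPsi oD1 CG BW BD1).
have /choice[Y YP] : forall i : 'I_3, exists Y : E -> R, forall x, ball w0 r x ->
    differentiable Y x /\ forall v, 'D_v Y x = \sum_k v k 0 * chart_coef Psi G i k x.
  move=> i; apply: (poincare (CA i)) => x j k Bx.
  exact: (chart_coef_closed oW sPsi PhiK SPhi oD1 CG GF BW BD1).
pose V := D `&` Phi @^-1` (ball w0 r).
have oB : open (ball w0 r) by exact: ball_open.
have oV : open V.
  rewrite openE => x [Dx Bx]; apply: filterI; first exact: open_nbhs_nbhs (conj oD Dx).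
  have cPhi : {for x, continuous Phi}.
    by apply: differentiable_continuous; exact: smooth_differentiable sPhi Dx.
  by apply: (cPhi (ball w0 r)); exact: open_nbhs_nbhs (conj oB Bx).
have Vp : V p by split=> //; exact: ballxx.
pose y (x : E) : E := \col_i Y i (Phi x).
have CY i : Ck 1 (ball w0 r) (Y i).
  apply: (C1_intro (V := R) (df := fun v x : E => \sum_k v k 0 * chart_coef Psi G i k x) oB).
  - by move=> x /(YP i)[].
  - by move=> v x /(YP i)[_]; apply.
  - move=> v x Bx; apply: (@C1_continuous _ _ _ (ball w0 r) _ _ _ Bx).
    apply: (C1_sum _ oB) => k.
    exact: (C1M oB (C1_cst _ (v k 0)) (CA i k)).
have CPhi : Ck 1 V Phi by apply: Ck_sub (smooth_C1 sPhi) => x [].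
have Cy : Ck 1 V y.
  apply/(C1_mxP _ oV) => i j.
  rewrite (_ : (fun _ => _) = Y i \o Phi); last by apply/funext => x; rewrite mxE.
  by apply: (C1_comp (D' := ball w0 r) oV _ CPhi (CY i)) => x [].
exists V, y; split=> // q Sq Vq; have [Dq Bq] := Vq.
have dy : differentiable y q by exact: Cy.1.
have nn : dot (nu q) (nu q) = 1 by have [_ /(_ q Sq)[]] := hnu.
apply: mulmx_col_ext => v; rewrite sgrad1_mul sder_setI//.
rewrite (sderE v hS hnu Sq (local_extension (f := y) oV Vq dy (fun _ _ _ => erefl))).
have tt : tangent S q (tproj (nu q) *m v).
  by apply: (orth_tangent hS hnu Sq); exact: dot_tproj.
have -> : F q *m v = F q *m (tproj (nu q) *m v).
  by rewrite mulmxA /tproj mulmxBr mulmx1 /outer [F q *m (_ *m _)]mulmxA F_normal// mul0mx subr0.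
apply/matrixP => i j; rewrite ord1 derive_mxE//.
rewrite (_ : (fun _ => _) = Y i \o Phi); last by apply/funext => x; rewrite mxE.
have [dY YE] := YP i _ Bq.
rewrite derive_comp//; last exact: smooth_differentiable sPhi Dq.
by rewrite YE (chart_coef_tangent oD sPhi sPsi PhiK SPhi GF BD1 i Bq Dq Sq tt).
Qed.

End LocalPrimitive.

Theorem mainTheorem5 (R : realType) (S : set 'cV[R]_3)
    (nu n1 n2 : 'cV[R]_3 -> 'cV[R]_3) (k1 k2 lam alpha : 'cV[R]_3 -> R)
    (hS : smooth_surface S) (hnu : unit_normal S nu)
    (hn1 : smooth_field S n1) (hn2 : smooth_field S n2)
    (hframe : forall p, S p -> pos_frame (n1 p) (n2 p) (nu p))
    (hcurv : forall p, S p ->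
       sgrad1 S nu nu p =
       k1 p *: outer (n1 p) (n1 p) + k2 p *: outer (n2 p) (n2 p))
    (hhyp : forall p, S p -> k2 p < 0 < k1 p)
    (hlam : Ck_field (V := R^o) 1 S lam)
    (halpha : Ck_field (V := R^o) 1 S alpha)
    (hlam_gt0 : forall p, S p -> 0 < lam p) :
  let U := fun p => lam p *: (k1 p *: outer (n1 p) (n1 p) -
                              k2 p *: outer (n2 p) (n2 p)) in
  let F := fun p => rotmx (nu p) (alpha p) *m U p in
  let c := fun p => (sgrad1 S nu n1 p)^T *m n2 p in
  let integrable := forall p, S p ->
    skw (sgrad2 S nu F p) =
    skw (outer21 (F p *m sgrad1 S nu nu p) (nu p)) in
  [/\ forall p, S p -> c p = - ((sgrad1 S nu n2 p)^T *m n1 p),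
      integrable <->
      (forall p, S p ->
         dot (sgrad0 S nu (fun q => lam q * k1 q * cos (alpha q)) p) (n2 p) -
         dot (sgrad0 S nu (fun q => lam q * k2 q * sin (alpha q)) p) (n1 p) =
         lam p * (k1 p + k2 p) *
           (cos (alpha p) * dot (c p) (n1 p) + sin (alpha p) * dot (c p) (n2 p))
         /\
         dot (sgrad0 S nu (fun q => lam q * k1 q * sin (alpha q)) p) (n2 p) +
         dot (sgrad0 S nu (fun q => lam q * k2 q * cos (alpha q)) p) (n1 p) =
         lam p * (k1 p + k2 p) *
           (sin (alpha p) * dot (c p) (n1 p) - cos (alpha p) * dot (c p) (n2 p)))
    & integrable ->
      forall p, S p -> exists V : set 'cV[R]_3, exists y : 'cV[R]_3 -> 'cV[R]_3,
        [/\ open V, V p, bending_neutral (S `&` V) nu y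
          & forall q, S q -> V q -> sgrad1 (S `&` V) nu y q = F q]].
Proof.
move=> U F c integrable; split.
- by move=> p Sp; exact: (connection_antisym hS hnu hn1 hn2 hframe hcurv hlam halpha).
- split=> H p Sp.
    exact: (integrable_iff_pde hS hnu hn1 hn2 hframe hcurv hlam halpha Sp).1 (H p Sp).
  exact: (integrable_iff_pde hS hnu hn1 hn2 hframe hcurv hlam halpha Sp).2 (H p Sp).
move=> hint p Sp.
have FC1 q : S q -> exists (D : set 'cV[R]_3) (G : 'cV[R]_3 -> 'M[R]_3),
    [/\ open D, D q, Ck 1 D G & forall x, D x -> S x -> G x = F x].
  exact: (local_gradient hS hnu hn1 hn2 hframe hcurv hlam halpha).
have Fnu q : S q -> F q *m nu q = 0 by exact: neutral_gradient_mul3.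
have Fsym q u v : S q -> tangent S q u -> tangent S q v ->
    sder S nu F q v *m u = sder S nu F q u *m v.
  move=> Sq tu tv; have [_ nuT] := hnu.2 q Sq.
  have := (skw_contract _ _ _ _ _ _).1 (hint q Sq) u v.
  by rewrite !nuT// !scale0r subrr => /subr0_eq.
have [V [y [oV Vp Cy yF]]] := local_primitive hS hnu FC1 Fnu Fsym Sp.
exists V, y; split=> //; split.
  by move=> q [Sq Vq]; exists V, y; split.
exists (fun q => rotmx (nu q) (alpha q)), U => q [Sq Vq].
split; last by exists (alpha q).
by rewrite yF//; exact: (neutral_polar alpha hframe Sq (hhyp q Sq) (hlam_gt0 q Sq)).
Qed.
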